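(* Consider the 1v1 reach-avoid differential game between an evader $E_i$ and a pursuer $P_j$ with speed ratio $\alpha_{ij}=U_i/V_j<1$, for states $\mathbf{x}=(\mathbf{x}_{E_i},\mathbf{x}_{P_j})\in\mathsf{R}_P$ (the pursuer winning region) that are not terminal, i.e. $\mathbf{x}_{E_i}\ne\mathbf{x}_{P_j}$. The Value function of the game is $C^1$, it is the solution of the Hamilton-Jacobi-Isaacs equation $$\min_{\|\mathbf{u}_i\|=U_i}\ \max_{\|\mathbf{v}_j\|=V_j}\Big[\Big\langle \tfrac{\partial \mathcal{V}}{\partial \mathbf{x}_{E_i}},\mathbf{u}_i\Big\rangle+\Big\langle \tfrac{\partial \mathcal{V}}{\partial \mathbf{x}_{P_j}},\mathbf{v}_j\Big\rangle\Big]=0,$$ and it is given by $$\mathcal{V}_{ij}^P(\mathbf{x})=R_{c_{ij}}-r_{c_{ij}},$$ where $$R_{c_{ij}}=\|\mathbf{x}_{c_{ij}}\|,\qquad \mathbf{x}_{c_{ij}}=\frac{\mathbf{x}_{E_i}-\alpha_{ij}^2\mathbf{x}_{P_j}}{1-\alpha_{ij}^2},\qquad r_{c_{ij}}=\frac{\alpha_{ij}}{1-\alpha_{ij}^2}\|\mathbf{x}_{P_j}-\mathbf{x}_{E_i}\|.$$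
   Context: 1v1 reach-avoid differential game: the evader $E_i$ at $\mathbf{x}_{E_i}\in\mathbb{R}^3$ and the pursuer $P_j$ at $\mathbf{x}_{P_j}\in\mathbb{R}^3$ move according to $\dot{\mathbf{x}}_{E_i}=\mathbf{u}_i$, $\dot{\mathbf{x}}_{P_j}=\mathbf{v}_j$, with controls satisfying $\|\mathbf{u}_i\|=U_i>0$, $\|\mathbf{v}_j\|=V_j>0$. The target is the origin. The game terminates when either the evader reaches the target ($\mathbf{x}_{E_i}=0$) or the evader is captured away from the target ($\mathbf{x}_{P_j}=\mathbf{x}_{E_i}\neq 0$). Pursuer winning region: $\mathsf{R}_P=\{\mathbf{x}\in\mathbb{R}^6:\|\mathbf{x}_{E_i}\|^2-\alpha_{ij}^2\|\mathbf{x}_{P_j}\|^2>0\}$; it is the set of initial states from which the pursuer can guarantee capture of the evader away from the target. Payoff in $\mathsf{R}_P$: $J(\mathbf{u}_i(\cdot),\mathbf{v}_j(\cdot);\mathbf{x}_0)=\|\mathbf{x}_{E_{i_f}}\|$, the distance of the terminal position $\mathbf{x}_{E_{i_f}}$ of the evader from the target. The evader minimizes and the pursuer maximizes. The Value function is $\mathcal{V}(\mathbf{x}_0)=\min_{\mathbf{u}_i(\cdot)}\max_{\mathbf{v}_j(\cdot)}J(\mathbf{u}_i(\cdot),\mathbf{v}_j(\cdot);\mathbf{x}_0)$ subject to the dynamics and termination rule, over state feedback strategies. *)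

(* Defs.v *)
From HB Require Import structures.
From mathcomp Require Import all_boot all_order all_algebra.
From mathcomp Require Import all_classical all_reals all_analysis.

Set Implicit Arguments.
Unset Strict Implicit.
Unset Printing Implicit Defensive.

Import Order.TTheory GRing.Theory Num.Theory.
Import numFieldNormedType.Exports.

Local Open Scope classical_set_scope.
Local Open Scope ring_scope.

(* The library norm on 'rV[R]_n is the sup norm; the Euclidean structure has to
   be added by hand. The topology is the same. *)
Definition dot (R : realType) (n : nat) (u v : 'rV[R]_n) : R :=
  \sum_(i < n) u 0 i * v 0 i.

Definition enorm (R : realType) (n : nat) (u : 'rV[R]_n) : R :=
  Num.sqrt (dot u u).

(* x.1 is the position of the evader, x.2 that of the pursuer. *)
Definition state (R : realType) : normedModType R :=
  ('rV[R]_3 * 'rV[R]_3)%type.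

Definition terminal (R : realType) (x : state R) : Prop :=
  x.1 = 0 \/ (x.2 = x.1 /\ x.1 <> 0).

(* State feedback strategies with speed s. Local Lipschitz continuity at the
   non-terminal states makes the closed-loop system well posed until the game
   terminates. Values at terminal states are irrelevant. *)
Definition feedback (R : realType) (s : R) (k : state R -> 'rV[R]_3) : Prop :=
  (forall x, enorm (k x) = s) /\
  (forall x, ~ terminal x ->
     exists2 A : set (state R), nbhs x A & [lipschitz k y | y in A]).

Definition is_play (R : realType) (mu nu : state R -> 'rV[R]_3) (x0 : state R)
    (T : R) (x : R -> state R) : Prop :=
  [/\ 0 <= T,
      x 0 = x0,
      {within `[0, T], continuous x},
      (forall t, 0 < t < T -> is_derive t 1 x (mu (x t), nu (x t))) &
      (forall t, 0 <= t < T -> ~ terminal (x t)) /\ terminal (x T)].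

(* [payoff mu nu x0 j] : the play of (mu, nu) from x0 terminates, and it does so
   with the evader at distance j from the target. The payoff is a terminal one:
   a play that never terminates has none, hence is never credited to the
   pursuer in the supremum below. *)
Definition payoff (R : realType) (mu nu : state R -> 'rV[R]_3) (x0 : state R)
    (j : R) : Prop :=
  exists T x, is_play mu nu x0 T x /\ j = enorm (x T).1.

Definition worst_payoff (R : realType) (V : R) (mu : state R -> 'rV[R]_3)
    (x0 : state R) : \bar R :=
  ereal_sup [set j%:E | j in
    [set j | exists2 nu, feedback V nu & payoff mu nu x0 j]].

Definition game_value (R : realType) (U V : R) (x0 : state R) : \bar R :=
  ereal_inf [set worst_payoff V mu x0 | mu in feedback U].

(* The inf and the sup in [game_value] are a min and a max. *)
Definition game_value_attained (R : realType) (U V : R) (x0 : state R) : Prop :=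
  exists mu, [/\ feedback U mu,
    worst_payoff V mu x0 = game_value U V x0 &
    exists nu j, [/\ feedback V nu, payoff mu nu x0 j &
                     j%:E = worst_payoff V mu x0]].

Definition pursuer_region (R : realType) (a : R) : set (state R) :=
  [set x | 0 < enorm x.1 ^+ 2 - a ^+ 2 * enorm x.2 ^+ 2].

Definition C1_on (R : realType) (D : set (state R)) (W : state R -> R) : Prop :=
  forall x, D x ->
    differentiable W x /\ forall h, {for x, continuous (fun y => 'D_h W y)}.

Definition grad1 (R : realType) (W : state R -> R) (x : state R) : 'rV[R]_3 :=
  \row_(i < 3) 'D_((delta_mx 0 i, 0) : state R) W x.

Definition grad2 (R : realType) (W : state R -> R) (x : state R) : 'rV[R]_3 :=
  \row_(i < 3) 'D_((0, delta_mx 0 i) : state R) W x.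

Definition is_max (R : realType) (A : set R) (m : R) : Prop := A m /\ ubound A m.

Definition is_min (R : realType) (A : set R) (m : R) : Prop := A m /\ lbound A m.

Definition HJI_at (R : realType) (U V : R) (W : state R -> R) (x : state R) :
    Prop :=
  is_min [set m | exists2 u : 'rV[R]_3, enorm u = U &
    is_max [set dot (grad1 W x) u + dot (grad2 W x) v
           | v in [set v : 'rV[R]_3 | enorm v = V]] m] 0.

Definition apollonius_center (R : realType) (a : R) (x : state R) : 'rV[R]_3 :=
  (1 - a ^+ 2)^-1 *: (x.1 - a ^+ 2 *: x.2).

Definition apollonius_radius (R : realType) (a : R) (x : state R) : R :=
  a / (1 - a ^+ 2) * enorm (x.2 - x.1).

(* Main.v *)
Require Import Defs.
From HB Require Import structures.
From mathcomp Require Import all_boot all_order all_algebra.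
From mathcomp Require Import all_classical all_reals all_analysis.
From mathcomp Require Import ring lra.

(** The claim is a saddle point in feedback strategies, proved by exhibiting,
    for each player, a strategy that guarantees the gap between the target and
    the Apollonius ball of the current state, i.e. [apollonius_gap a x] :=
    |c| - r with c the center and r the radius of the ball.

    Pursuer.  Against a given evader feedback mu, let the pursuer copy the
    component of mu orthogonal to the line of sight and spend the rest of its
    speed along it ([parallel_pursuit]).  For any two headings with speed ratio
    a, |mu - a^2 nu| = a |mu - nu|; under parallel pursuit this says that the
    center moves exactly as fast as the radius shrinks.  So the Apollonius balls
    of the play are nested, and capture, which happens inside all of them, is at
    least as far from the target as the first ball ([closing_payoff_ge]).  As
    the distance of the players decreases at rate at least V - U, the play ends
    in finite time.

    Evader.  Steering to the point of the ball closest to the target means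
    following the steepest descent of the gap.  The gradients of the gap satisfy
    |grad2| = a |grad1|, so whatever the pursuer does the gap does not increase
    while it is positive, and it equals the distance to the target at capture
    ([evader_payoff_le]).  Outside the pursuer's region, the same formula, with
    |c| replaced by max (|c|, r), steers straight to the target and keeps the
    feedback locally Lipschitz on all non-terminal states.

    The first half needs, for an arbitrary mu, that the closed-loop play exists:
    it is a theorem about a field f that is only locally Lipschitz on an open
    set G.  Instead of glueing local solutions, f is slowed down by the factor
    [lip_radius f G], the largest radius on which f is Lipschitz with the inverse
    radius as constant.  The product is globally Lipschitz, so the Picard
    iteration gives a solution for all times that never leaves G; undoing the
    change of time yields the trajectory of f until it exits G
    ([exit_solution]).

    Once the value is known to be the gap, differentiability and the Isaacs
    equation follow from the explicit gradients: the minimum over u of the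
    maximum over v of <p, u> + <q, v> is V |q| - U |p|, which is zero because
    |q| = a |p|. *)

Import Order.TTheory GRing.Theory Num.Theory.
Import numFieldNormedType.Exports.

Local Open Scope classical_set_scope.
Local Open Scope ring_scope.

Set Implicit Arguments.
Unset Strict Implicit.
Unset Printing Implicit Defensive.

(** * Curves and derivatives in row-vector spaces *)

Lemma is_derive_rVP (R : realFieldType) (V : normedModType R) (n : nat)
    (w : V -> 'rV[R]_n) (dw : 'rV[R]_n) (t v : V) :
  is_derive t v w dw <->
  (forall i, is_derive t v (fun x => w x 0 i) (dw 0 i)).
Proof.
split=> [[dwt <-] i|dwi].
  split; first exact: (derivable_mxP _ _ _).1.
  by rewrite derive_mx// mxE.
have dvw : derivable w t v.
  by apply/derivable_mxP => i j; rewrite (ord1 i); case: (dwi j).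
split=> //; rewrite derive_mx//; apply/rowP => j; rewrite mxE.
by case: (dwi j).
Qed.

Lemma normr_coord_le (R : realFieldType) (n : nat) (x : 'rV[R]_n) i :
  `|x 0 i| <= `|x|.
Proof.
rewrite [leRHS]/Num.Def.normr /= mx_normrE.
exact: (le_bigmax _ (fun ij : 'I_1 * 'I_n => `|x ij.1 ij.2|) (ord0, i)).
Qed.

Lemma normr_rV_le (R : realFieldType) (n : nat) (x : 'rV[R]_n) (c : R) :
  0 <= c -> (forall i, `|x 0 i| <= c) -> `|x| <= c.
Proof.
move=> c0 xc; rewrite [leLHS]/Num.Def.normr /= mx_normrE.
by apply/bigmax_leP; split=> // -[i j] _ /=; rewrite (ord1 i).
Qed.

Lemma is_derive_continuous (R : realFieldType) (V : normedModType R)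
    (w : R -> V) (dw : V) (t : R) :
  is_derive t 1 w dw -> {for t, continuous w}.
Proof.
by move=> [/derivable1_diffP/differentiable_continuous].
Qed.

Lemma derive_ge0_le (R : realType) (h dh : R -> R) (a b : R) : a <= b ->
  {within `[a, b], continuous h} ->
  (forall t, a < t < b -> is_derive t 1 h (dh t)) ->
  (forall t, a < t < b -> 0 <= dh t) -> h a <= h b.
Proof.
move=> ab ch hd dh0; apply: (@ger0_derive1_le_cc _ h a b) => //.
- by move=> x; rewrite in_itv/= => /hd [].
- by move=> x; rewrite in_itv/= => axb; rewrite derive1E; case: (hd _ axb) => _
      ->; apply: dh0.
- by rewrite in_itv/= lexx.
- by rewrite in_itv/= lexx ab.
Qed.

(** Mean value inequality for curves. The norm of ['rV_n] is the maximum of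
    the coordinates, so the scalar case applied to both signs of each coordinate
    suffices. *)
Lemma derive_norm_le (R : realType) (n : nat) (w dw : R -> 'rV[R]_n)
    (k dk : R -> R) (a b : R) : a <= b ->
  {within `[a, b], continuous w} -> {within `[a, b], continuous k} ->
  (forall t, a < t < b -> is_derive t 1 w (dw t)) ->
  (forall t, a < t < b -> is_derive t 1 k (dk t)) ->
  (forall t, a < t < b -> `|dw t| <= dk t) -> `|w b - w a| <= k b - k a.
Proof.
move=> ab cw ck wd kd dwk.
have cwi i : {within `[a, b], continuous (fun x => w x 0 i)}.
  move=> x; apply: (@continuous_comp (subspace `[a, b]%classic) _ _ w (fun v :
      'rV[R]_n => v 0 i)).
    exact: cw.
  exact: coord_continuous.
have le1 (s : bool) i : (-1) ^+ s * (w b 0 i - w a 0 i) <= k b - k a.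
  suff : k a - (-1) ^+ s * w a 0 i <= k b - (-1) ^+ s * w b 0 i by lra.
  apply: (@derive_ge0_le _ (fun x => k x - (-1) ^+ s * w x 0 i)
     (fun x => dk x - (-1) ^+ s * dw x 0 i)) => //.
  - move=> x; apply: (@cvgB _ _ (subspace `[a, b]%classic)); first exact: ck.
    apply: (@cvgM _ (subspace `[a, b]%classic)); first exact: cvg_cst.
    exact: cwi.
  - move=> t /[dup] /kd kdt /wd /is_derive_rVP /(_ i) wdt.
    exact: is_deriveB.
  - move=> t /dwk; rewrite subr_ge0; apply: le_trans.
    rewrite (le_trans (ler_norm _))// normrM normrX normrN1 expr1n mul1r.
    exact: normr_coord_le.
apply: normr_rV_le => [|i].
  rewrite subr_ge0; apply: (@derive_ge0_le _ k dk) => // t /dwk.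
  exact/le_trans/normr_ge0.
rewrite !mxE ler_norml; apply/andP; split.
  by have := le1 true i; rewrite expr1 mulN1r; lra.
by have := le1 false i; rewrite expr0 mul1r.
Qed.

(** Starting the integral at -1 instead of 0 makes the derivative two-sided
    at 0 as well. *)
Lemma primitive (R : realType) (h : R -> R) : continuous h ->
  exists2 H : R -> R, H 0 = 0 & forall t : R, 0 <= t -> is_derive t 1 H (h t).
Proof.
move=> ch.
pose F (x : R) := (\int[lebesgue_measure]_(t in `[(-1 : R), x]) (h t))%R.
have Fd (t : R) : 0 <= t -> is_derive t 1 F (h t).
  move=> t0; have [||||d1 d2] := @continuous_FTC1_closed _ h (-1) t (t + 1).
  - by rewrite ltrDl.
  - apply: continuous_compact_integrable; first exact: segment_compact.
    exact: continuous_subspaceT.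
  - lra.
  - exact: ch.
  by split; [exact: d1|rewrite -derive1E].
exists (fun x => F x - F 0); first by rewrite subrr.
move=> t t0; rewrite -[h t]subr0; apply: is_deriveB; exact: Fd.
Qed.

Lemma primitive_rV (R : realType) (n : nat) (h : R -> 'rV[R]_n) :
  continuous h ->
  exists2 H : R -> 'rV[R]_n, H 0 = 0 &
    forall t : R, 0 <= t -> is_derive t 1 H (h t).
Proof.
move=> ch.
have /choice[H HP] (i : 'I_n) : exists H : R -> R,
    H 0 = 0 /\ forall t : R, 0 <= t -> is_derive t 1 H (h t 0 i).
  have [|H H0 dH] := @primitive _ (fun t => h t 0 i); last by exists H.
  move=> x; apply: (@continuous_comp _ _ _ h (fun v : 'rV[R]_n => v 0 i)).
    exact: ch.
  exact: coord_continuous.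
exists (fun t => \row_i H i t).
  by apply/rowP => i; rewrite !mxE; case: (HP i).
move=> t t0; apply/is_derive_rVP => i.
under [X in is_derive _ _ X _]eq_fun do rewrite mxE.
exact: (HP i).2.
Qed.

(** Directional derivatives are derivatives along a line; this transfers
    results about functions of one real variable. *)
Lemma is_derive_lineP (R : realFieldType) (V W : normedModType R) (f : V -> W)
    (x v : V) (df : W) :
  is_derive x v f df <-> is_derive (0 : R) 1 (fun t : R => f (t *: v + x)) df.
Proof.
have E : (fun t : R => t^-1 *: ((f \o shift x) (t *: v) - f x)) =
  (fun t : R => t^-1 *: (((fun t : R => f (t *: v + x)) \o shift 0) (t *: 1) -
                         f (0 *: v + x))).
  by apply/funext => t /=; rewrite addr0 scale0r add0r [_%:A]mulr1.
split=> -[fd <-].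
- split; first by move: fd; rewrite /derivable E.
  by rewrite /derive -E.
- split; first by rewrite /derivable E.
  by rewrite /derive E.
Qed.

Lemma is_derive_comp1 (R : realType) (V : normedModType R) (f : R -> R)
    (w : V -> R) (df dw : R) (x h : V) :
  is_derive (w x) 1 f df -> is_derive x h w dw ->
  is_derive x h (fun y => f (w y)) (df * dw).
Proof.
move=> fd /is_derive_lineP wd; apply/is_derive_lineP.
apply: (@is_derive1_comp _ f (fun t : R => w (t *: h + x))).
by rewrite scale0r add0r.
Qed.

Lemma is_derive_cvgP (R : realFieldType) (V W : normedModType R) (f : V -> W)
    (x v : V) (df : W) :
  is_derive x v f df <->
  (fun h : R => h^-1 *: ((f \o shift x) (h *: v) - f x)) @ 0^' --> df.
Proof.
split=> [[fd <-]|fd]; first exact: fd.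
by split; [apply/cvg_ex; exists df|exact/cvg_lim].
Qed.

Lemma is_derive_pairP (R : realFieldType) (U V W : normedModType R)
    (f : U -> (V * W)%type) (x v : U) (df : (V * W)%type) :
  is_derive x v f df <-> is_derive x v (fun y => (f y).1) df.1 /\
                         is_derive x v (fun y => (f y).2) df.2.
Proof.
split=> [/is_derive_cvgP fd|[/is_derive_cvgP d1 /is_derive_cvgP d2]].
  split; apply/is_derive_cvgP.
    exact: (cvg_comp _ _ fd (@cvg_fst _ _ _ _ _)).
  exact: (cvg_comp _ _ fd (@cvg_snd _ _ _ _ _)).
apply/is_derive_cvgP.
case: df d1 d2 => df1 df2 d1 d2; exact: cvg_pair d1 d2.
Qed.

(** The linear part of [f] serves for [g], as the remainder is only
    tested near [x]. *)
Lemma near_eq_differentiable (R : realType) (V W : normedModType R)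
    (f g : V -> W) (x : V) :
  (\near x, f x = g x) -> differentiable f x -> differentiable g x.
Proof.
move=> fg df.
have E : g \o shift x = cst (g x) + 'd f x +o_ 0 id.
  apply/eqaddoP => e e0.
  have /eqaddoP/(_ e e0) := diff_locally df.
  have fg0 : \forall y \near (0 : V), f (y + x) = g (y + x).
    by move: fg; rewrite (near_shift 0) subr0.
  rewrite -(nbhs_singleton fg) => fe; near=> y.
  rewrite [X in `|X|](_ : _ = (f \o shift x - (cst (f x) + 'd f x)) y); first
      by near: y.
  by rewrite !fctE /= (near fg0 y).
have dE : 'd g x = 'd f x :> (V -> W) by apply: diff_unique => //; exact:
    diff_continuous.
by apply/diff_locallyP; rewrite dE; split=> //; exact: diff_continuous.
Unshelve. all: by end_near. Qed.

Lemma lipschitz_continuous (R : realType) (V W : normedModType R) (f : V -> W)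
    (k : R) : (forall x y, `|f x - f y| <= k * `|x - y|) -> continuous f.
Proof.
move=> fk x; apply/cvgrPdist_le => e e0.
have k0 : 0 < `|k| + 1 by rewrite ltr_pwDr.
near=> y.
apply: (le_trans (fk x y)).
apply: (@le_trans _ _ ((`|k| + 1) * `|x - y|)).
  by apply: ler_wpM2r => //; rewrite (le_trans (ler_norm _))// lerDl.
rewrite mulrC -ler_pdivlMr//; near: y.
by apply: cvgr_dist_le; [exact: cvg_id|rewrite divr_gt0].
Unshelve. all: by end_near. Qed.

Lemma within_lipschitz_continuous (R : realType) (V W : normedModType R)
    (A : set V) (f : V -> W) (k : R) :
  (forall x y, A x -> A y -> `|f x - f y| <= k * `|x - y|) ->
  {within A, continuous f}.
Proof.
move=> fk; apply/subspace_continuousP => x Ax.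
apply/cvgrPdist_le => e e0.
have k0 : 0 < `|k| + 1 by rewrite ltr_pwDr.
near=> y.
have Ay : A y by near: y; exact: withinT.
apply: (le_trans (fk x y Ax Ay)).
apply: (@le_trans _ _ ((`|k| + 1) * `|x - y|)).
  by apply: ler_wpM2r => //; rewrite (le_trans (ler_norm _))// lerDl.
rewrite mulrC -ler_pdivlMr//; near: y.
apply: cvg_within.
by apply: (@cvgr_dist_le _ _ _ _ _ id) => //; rewrite divr_gt0.
Unshelve. all: by end_near. Qed.

Lemma near_neq0 (R : realType) (T : topologicalType) (V : normedModType R)
    (f : T -> V) (x : T) : {for x, continuous f} -> f x != 0 ->
  \forall y \near x, f y != 0.
Proof.
move=> fx fx0; have : \forall y \near x, `|f x - f y| < `|f x|.
  by move/cvgrPdist_lt : fx; apply; rewrite normr_gt0.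
apply: filterS => y; apply: contraTneq => ->.
by rewrite subr0 ltxx.
Qed.

(** * Ordinary differential equations with globally Lipschitz right-hand side *)

Lemma le_add_halfpow (R : realType) (a b c : R) :
  (forall n, a <= b + c / 2 ^+ n) -> a <= b.
Proof.
move=> abc.
have h : (fun n : nat => b + c / 2 ^+ n) @ \oo --> b.
  rewrite -[X in _ --> X]addr0 -[X in _ --> _ + X](mulr0 c).
  apply: cvgD; first exact: cvg_cst.
  apply: cvgM; first exact: cvg_cst.
  under eq_fun do rewrite -exprVn.
  by apply: cvg_expr; rewrite ger0_norm ?invr_ge0// invf_lt1// ltr1n.
by apply: (cvgr_to_ge h); apply: nearW.
Qed.

Lemma cauchy_bound_lim (R : realType) (n : nat) (u : nat -> 'rV[R]_n)
    (b : nat -> R) : b @ \oo --> 0 ->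
  (forall k m, (k <= m)%N -> `|u m - u k| <= b k) ->
  exists l, forall k, `|l - u k| <= b k.
Proof.
move=> b0 ub.
have /cvg_ex[l ul] : cvg (u @ \oo).
  apply/cauchy_cvgP/cauchy_ballP => e e0.
  have /= : \forall k \near \oo, `|b k| < e / 2.
    by move/cvgr0_norm_lt : b0; apply; rewrite divr_gt0.
  case=> N _ bN; rewrite near_simpl/=.
  exists ([set k | (N <= k)%N], [set k | (N <= k)%N]) => /=.
    by split; exists N.
  move=> [k m] /= [Nk Nm].
  have hb i : (N <= i)%N -> `|u i - u N| < e / 2.
    move=> Ni; apply: (le_lt_trans (ub _ _ Ni)).
    exact: le_lt_trans (ler_norm _) (bN _ (leqnn N)).
  rewrite mx_norm_ball /ball_ /=.
  rewrite (splitr e); apply: le_lt_trans (ltrD (hb _ Nk) (hb _ Nm)).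
  by rewrite -(normrN (u m - u N)) opprB (le_trans _ (ler_normD _ _))// addrA
      subrK.
exists l => k.
have h : (fun m => `|u m - u k|) @ \oo --> `|l - u k|.
  by apply: cvg_norm; apply: cvgB => //; exact: cvg_cst.
apply: (cvgr_to_le h); exists k => // m /= km; exact: ub.
Qed.

(** Picard iteration. Distances at time [t] are measured against
    [expR (2 * L * t)]: integrating a bound by this weight divides it by [2 * L],
    so that each step contracts by 1/2 on the whole half-line at once. The
    arguments of the iterates are taken in absolute value, since only
    nonnegative times are controlled. *)
Lemma global_solution (R : realType) (n : nat) (g : 'rV[R]_n -> 'rV[R]_n)
    (x0 : 'rV[R]_n) (L M : R) : 0 < L ->
  (forall x y, `|g x - g y| <= L * `|x - y|) -> (forall x, `|g x| <= M) ->
  exists2 z : R -> 'rV[R]_n, z 0 = x0 &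
    forall t : R, 0 <= t -> is_derive t 1 z (g (z t)).
Proof.
move=> L0 gL gM.
have /choice[I IP] (h : R -> 'rV[R]_n) : exists H : R -> 'rV[R]_n, continuous h
    ->
    H 0 = 0 /\ forall t : R, 0 <= t -> is_derive t 1 H (h t).
  have [/primitive_rV[H H0 dH]|nch] := pselect (continuous h); first by exists
      H.
  by exists h => /nch.
pose good (w : R -> 'rV[R]_n) := forall t : R, 0 <= t -> {for t, continuous w}.
pose step (w : R -> 'rV[R]_n) (t : R) := x0 + I (fun s => g (w `|s|)) t.
have cg : continuous g by exact: lipschitz_continuous gL.
have good_cont w : good w -> continuous (fun s : R => g (w `|s|)).
  move=> gw s; apply: (@continuous_comp _ _ _ (fun s : R => w `|s|) g).
    apply: (@continuous_comp _ _ _ (fun s : R => `|s|) w).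
      exact: norm_continuous.
    exact: gw.
  exact: cg.
have step0 w : good w -> step w 0 = x0.
  by move=> /good_cont /IP[I0 _]; rewrite /step I0 addr0.
have dstep w (t : R) : good w -> 0 <= t -> is_derive t 1 (step w) (g (w t)).
  move=> /good_cont /IP[_ dI] t0; rewrite -[g _]add0r /step; apply: is_deriveD.
  by have := dI t t0; rewrite ger0_norm.
have good_step w : good w -> good (step w).
  by move=> gw t t0; apply: is_derive_continuous (dstep _ _ gw t0).
pose z k := iter k step (cst x0).
have gz k : good (z k).
  elim: k => [|k ih]; last exact: good_step.
  move=> t _; exact: cst_continuous.
have dz k (t : R) : 0 <= t -> is_derive t 1 (z k.+1) (g (z k t)).
  exact: dstep.
pose e c (t : R) := c * expR (2 * L * t).
have de c (t : R) : is_derive t 1 (e c) (2 * L * e c t).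
  rewrite /e; apply: is_derive_eq.
  by rewrite /GRing.scale /= mulr1; ring.
(* Weighted by exp (2 L t), one Picard step halves the distance. *)
have est (w v : R -> 'rV[R]_n) (dw dv : R -> 'rV[R]_n) c : 0 <= c ->
    w 0 = v 0 ->
    (forall t : R, 0 <= t -> is_derive t 1 w (dw t)) ->
    (forall t : R, 0 <= t -> is_derive t 1 v (dv t)) ->
    (forall t : R, 0 <= t -> `|dw t - dv t| <= 2 * L * e c t) ->
    forall t : R, 0 <= t -> `|w t - v t| <= e c t.
  move=> c0 wv0 wd vd wvd t t0.
  have D (s : R) : 0 <= s -> is_derive s 1 (fun s => w s - v s) (dw s - dv s).
    by move=> s0; apply: is_deriveB; [exact: wd|exact: vd].
  have := @derive_norm_le _ _ (fun s => w s - v s) (fun s => dw s - dv s) (e c)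
    (fun s => 2 * L * e c s) 0 t t0.
  rewrite wv0 subrr subr0 => /(_ _ _ _ _ _)/le_trans; apply.
  - apply: derivable_within_continuous => s; rewrite in_itv/= => /andP[s0 _].
    by have [] := D s s0.
  - by apply: continuous_subspaceT => s; apply: is_derive_continuous (de c s).
  - by move=> s /andP[/ltW s0 _]; exact: D.
  - by move=> s /andP[/ltW s0 _]; exact: wvd.
  - by rewrite lerBlDr lerDl /e mulr_ge0// expR_ge0.
pose C := M / (2 * L).
have M0 : 0 <= M by apply: le_trans (gM x0).
have C0 : 0 <= C by rewrite divr_ge0// mulr_ge0// ltW.
have exp1 (t : R) : 0 <= t -> 1 <= expR (2 * L * t).
  by move=> t0; rewrite -expR0 ler_expR !mulr_ge0// ltW.
have z0 k : z k 0 = x0 by case: k => [//|k]; exact: step0.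
have zz k (t : R) : 0 <= t -> `|z k.+1 t - z k t| <= e (C / 2 ^+ k) t.
  elim: k t => [|k ih] t t0.
    rewrite expr0 divr1.
    apply: (est (z 1%N) (z 0%N) (fun t => g (z 0%N t)) (cst 0)) => //.
    move=> s s0; rewrite subr0 (le_trans (gM _))//.
    have -> : 2 * L * e C s = M * expR (2 * L * s).
        by rewrite /e /C; field; rewrite gt_eqF.
    by rewrite ler_peMr// exp1.
  apply: (est _ _ (fun t => g (z k.+1 t)) (fun t => g (z k t))) => //.
  - by rewrite divr_ge0// exprn_ge0.
  - by rewrite !z0.
  - move=> s s0; rewrite (le_trans (gL _ _))//.
    rewrite (_ : 2 * L * _ = L * e (C / 2 ^+ k) s).
      by rewrite ler_pM2l// ih.
    rewrite /e exprS; field.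
    by rewrite expf_neq0.
have zC k m (t : R) : 0 <= t -> (k <= m)%N ->
    `|z m t - z k t| <= 2 * (e (C / 2 ^+ k) t - e (C / 2 ^+ m) t).
  move=> t0 /subnKC <-; elim: (m - k)%N => [|i ih] {m}.
    by rewrite addn0 !subrr normr0 mulr0.
  rewrite addnS.
  have -> : 2 * (e (C / 2 ^+ k) t - e (C / 2 ^+ (k + i).+1) t) =
     e (C / 2 ^+ (k + i)) t + 2 * (e (C / 2 ^+ k) t - e (C / 2 ^+ (k + i)) t).
    rewrite /e [2 ^+ (k + i).+1]exprS; field.
    by rewrite !expf_neq0.
  rewrite -(subrK (z (k + i)%N t) (z (k + i).+1 t)) -addrA.
  by rewrite (le_trans (ler_normD _ _))// lerD// zz.
have e2 k t : e (C / 2 ^+ k) t = e C t / 2 ^+ k by rewrite /e mulrAC.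
have e0 c (t : R) : 0 <= c -> 0 <= e c t.
  by move=> c0; rewrite mulr_ge0// expR_ge0.
have cpow c : (fun k => c / 2 ^+ k : R) @ \oo --> 0.
  rewrite -(mulr0 c); apply: cvgM; first exact: cvg_cst.
  under eq_fun do rewrite -exprVn.
  by apply: cvg_expr; rewrite ger0_norm ?invr_ge0// invf_lt1// ltr1n.
have /choice[zl zlP] (t : R) : exists l, 0 <= t ->
    forall k, `|l - z k t| <= 2 * e C t / 2 ^+ k.
  have [t0|] := leP 0 t; last by exists 0.
  have [|k m km|l lP] := @cauchy_bound_lim _ _ (fun k => z k t)
    (fun k => 2 * e C t / 2 ^+ k); last by exists l.
  - exact: cpow.
  - rewrite (le_trans (zC _ _ _ t0 km))// -mulrA ler_pM2l// e2 lerBlDr lerDl.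
    by rewrite e0// divr_ge0// exprn_ge0.
have zM k (s t : R) : 0 <= s -> s <= t -> `|z k t - z k s| <= M * `|t - s|.
  move=> s0 st; case: k => [|k]; first by rewrite subrr normr0 mulr_ge0.
  rewrite ger0_norm ?subr_ge0// mulrBr.
  have dM (u : R) : is_derive u 1 (fun u => M * u) M.
    by apply: is_derive_eq; rewrite /GRing.scale /= mulr1.
  apply: (@derive_norm_le _ _ _ (fun s => g (z k s)) _ (cst M)) => //.
  - apply: derivable_within_continuous => u; rewrite in_itv/= => /andP[su _].
    by have [] := dz k u (le_trans s0 su).
  - apply: derivable_within_continuous => u _; by have [] := dM u.
  - by move=> u /andP[/ltW su _]; apply: dz; apply: le_trans su.
have zlM (s t : R) : 0 <= s -> s <= t -> `|zl t - zl s| <= M * `|t - s|.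
  move=> s0 st; have t0 := le_trans s0 st.
  apply: (@le_add_halfpow _ _ _ (2 * e C t + 2 * e C s)) => k.
  rewrite mulrDl.
  rewrite (_ : zl t - zl s = (z k t - z k s) + ((zl t - z k t) - (zl s - z k
      s))).
    rewrite (le_trans (ler_normD _ _))// lerD ?zM//.
    by rewrite (le_trans (ler_normB _ _))// lerD// zlP.
  by apply/rowP => i; rewrite !mxE; ring.
have cl : continuous (fun s : R => g (zl `|s|)).
  move=> s; apply: (@continuous_comp _ _ _ (fun s : R => zl `|s|) g); last
      exact: cg.
  apply: (@lipschitz_continuous _ R _ _ M) => {}s t.
  have [st|/ltW st] := leP `|s| `|t|.
    rewrite -normrN opprB (le_trans (zlM _ _ _ st))// ler_wpM2l//.
    by rewrite (distrC s) ler_dist_dist.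
  by rewrite (le_trans (zlM _ _ _ st))// ler_wpM2l// ler_dist_dist.
have [I0 dI] := IP _ cl.
pose y (t : R) := x0 + I (fun s => g (zl `|s|)) t.
have dy (t : R) : 0 <= t -> is_derive t 1 y (g (zl t)).
  move=> t0; rewrite -[g _]add0r /y; apply: is_deriveD.
  by have := dI t t0; rewrite ger0_norm.
have y0 : y 0 = x0 by rewrite /y I0 addr0.
have yzl (t : R) : 0 <= t -> y t = zl t.
  move=> t0; apply/eqP; rewrite -subr_eq0 -normr_le0.
  apply: (@le_add_halfpow _ _ _ (2 * e C t)) => k; rewrite add0r.
  have yz : `|y t - z k.+1 t| <= e (2 * C / 2 ^+ k.+1) t.
    apply: (est _ _ (fun t => g (zl t)) (fun t => g (z k t))) => //.
    - by apply: divr_ge0; [exact: mulr_ge0|exact: exprn_ge0].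
    - by rewrite y0 z0.
    - move=> s s0; rewrite (le_trans (gL _ _))//.
      rewrite (_ : 2 * L * _ = L * (2 * e C s / 2 ^+ k)).
        by rewrite ler_pM2l// zlP.
      rewrite /e exprS; field.
      by rewrite expf_neq0.
  rewrite -(subrK (z k.+1 t) (y t)) -addrA.
  rewrite (le_trans (ler_normD _ _))//.
  apply: (le_trans (lerD yz _)); first by rewrite -normrN opprB; exact: zlP.
  rewrite le_eqVlt; apply/orP; left; apply/eqP.
  rewrite /e exprS; field.
  by rewrite expf_neq0.
exists y => // t t0; rewrite yzl//; exact: dy.
Qed.

(** Backward uniqueness of a rest point: a curve whose speed is bounded by
    its distance to its final point has always been there. The proof improves an
    a priori bound by 1/2 repeatedly, with an exponential weight. *)
Lemma gronwall_cst (R : realType) (n : nat) (z dz : R -> 'rV[R]_n)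
    (L b : R) : 0 < L -> 0 <= b ->
  (forall t : R, 0 <= t <= b -> is_derive t 1 z (dz t)) ->
  (forall t : R, 0 <= t <= b -> `|dz t| <= L * `|z b - z t|) ->
  z 0 = z b.
Proof.
move=> L0 b0 zd dzL.
have cz s t : 0 <= s -> t <= b -> {within `[s, t], continuous z}.
  move=> s0 tb; apply: derivable_within_continuous => u.
  rewrite in_itv/= => /andP[su ut].
  have /zd[] // : 0 <= u <= b by rewrite (le_trans s0 su) (le_trans ut tb).
have [K K0 zK] : exists2 K, 0 <= K & forall t, 0 <= t <= b -> `|z b - z t| <= K.
  have /(EVT_max b0)[c _ cP] : {within `[0, b], continuous (fun t => `|z b - z
      t|)}.
    move=> x; apply: (@continuous_comp (subspace `[0, b]%classic) _ _ (fun t =>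
        z b - z t) Num.norm); last exact: norm_continuous.
    apply: (@cvgB _ _ (subspace `[0, b]%classic)); first exact: cvg_cst.
    exact: cz.
  exists `|z b - z c| => // t tb; apply: cP; by rewrite in_itv/=.
have h k t : 0 <= t <= b -> `|z b - z t| <= K * expR (2 * L * (b - t)) / 2 ^+ k.
  elim: k t => [|k ih] t tb.
    rewrite expr0 divr1 (le_trans (zK _ tb))// ler_peMr//.
    rewrite -expR0 ler_expR; case/andP: tb => _ tb.
    by rewrite mulr_ge0 ?subr_ge0// mulr_ge0// ltW.
  pose e (s : R) := - (K / 2 ^+ k.+1) * expR (2 * L * (b - s)).
  have de (s : R) : is_derive s 1 e (L * (K * expR (2 * L * (b - s)) / 2 ^+ k)).
    rewrite /e; apply: is_derive_eq.
    rewrite /GRing.scale /= exprS; field.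
    by rewrite expf_neq0.
  case/andP: (tb) => t0 tleb.
  apply: (@le_trans _ _ (e b - e t)).
    apply: (@derive_norm_le _ _ z dz e
      (fun s => L * (K * expR (2 * L * (b - s)) / 2 ^+ k))) => //.
    - exact: cz.
    - by apply: derivable_within_continuous => s _; have [] := de s.
    - by move=> s /andP[/ltW ts /ltW sb]; apply: zd; rewrite sb (le_trans t0
          ts).
    - move=> s /andP[/ltW ts /ltW sb].
      have sb' : 0 <= s <= b by rewrite sb (le_trans t0 ts).
      by rewrite (le_trans (dzL _ sb'))// ler_pM2l// ih.
  rewrite /e subrr mulr0 expR0 mulr1 mulNr opprK addrC -mulrAC lerBlDr lerDl.
  by rewrite divr_ge0// exprn_ge0.
apply/eqP; rewrite eq_sym -subr_eq0 -normr_le0.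
apply: (@le_add_halfpow _ _ _ (K * expR (2 * L * (b - 0)))) => k; rewrite add0r.
by apply: h; rewrite lexx b0.
Qed.

(** * Trajectories of locally Lipschitz fields up to the exit of an open set *)

(** The radii [r] such that [f] is [r^-1]-Lipschitz on the ball of radius
    [r] around [y] and this ball lies in [G]. Multiplying by [r] instead of
    dividing keeps 0 among them. *)
Definition lip_radii (R : realType) (n : nat) (f : 'rV[R]_n -> 'rV[R]_n)
    (G : set 'rV[R]_n) (y : 'rV[R]_n) : set R :=
  [set r | 0 <= r <= 1 /\ forall a b, `|a - y| < r -> `|b - y| < r ->
     G a /\ r * `|f a - f b| <= `|a - b|].

Definition lip_radius (R : realType) (n : nat) (f : 'rV[R]_n -> 'rV[R]_n)
    (G : set 'rV[R]_n) (y : 'rV[R]_n) : R := sup (lip_radii f G y).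

Lemma lip_radii_has_sup (R : realType) (n : nat) (f : 'rV[R]_n -> 'rV[R]_n)
    (G : set 'rV[R]_n) (y : 'rV[R]_n) : has_sup (lip_radii f G y).
Proof.
split; last by exists 1 => r [/andP[]].
exists 0; split; first by rewrite lexx ler01.
by move=> a b; rewrite ltNge normr_ge0.
Qed.

Lemma lip_radius_ge (R : realType) (n : nat) (f : 'rV[R]_n -> 'rV[R]_n)
    (G : set 'rV[R]_n) (y : 'rV[R]_n) (r : R) :
  lip_radii f G y r -> r <= lip_radius f G y.
Proof. exact/sup_upper_bound/lip_radii_has_sup. Qed.

Lemma lip_radius_ge0 (R : realType) (n : nat) (f : 'rV[R]_n -> 'rV[R]_n)
    (G : set 'rV[R]_n) (y : 'rV[R]_n) : 0 <= lip_radius f G y.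
Proof.
apply: lip_radius_ge; split; first by rewrite lexx ler01.
by move=> a b; rewrite ltNge normr_ge0.
Qed.

Lemma lip_radius_le1 (R : realType) (n : nat) (f : 'rV[R]_n -> 'rV[R]_n)
    (G : set 'rV[R]_n) (y : 'rV[R]_n) : lip_radius f G y <= 1.
Proof.
apply: ge_sup; first exact: (lip_radii_has_sup f G y).1.
by move=> r [/andP[]].
Qed.

(** A radius [r] at [y] gives the radius [r - `|y - y'|] at [y'],
    because the smaller ball is contained in the larger. *)
Lemma lip_radius_lipschitz (R : realType) (n : nat) (f : 'rV[R]_n -> 'rV[R]_n)
    (G : set 'rV[R]_n) (y y' : 'rV[R]_n) :
  `|lip_radius f G y - lip_radius f G y'| <= `|y - y'|.
Proof.
wlog : y y' / lip_radius f G y' <= lip_radius f G y => [h|].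
  have [/h//|/ltW /h] := leP (lip_radius f G y') (lip_radius f G y).
  by rewrite distrC [leRHS]distrC.
rewrite -subr_ge0 => /ger0_norm ->; rewrite lerBlDr.
apply: ge_sup; first exact: (lip_radii_has_sup f G y).1.
move=> r [/andP[r0 r1] rP].
rewrite -lerBlDl.
have [r0'|] := leP 0 (r - `|y - y'|); last first.
  by move=> /ltW /le_trans; apply; exact: lip_radius_ge0.
apply: lip_radius_ge; split.
  by rewrite r0' (le_trans _ r1)// gerBl.
have h a : `|a - y'| < r - `|y - y'| -> `|a - y| < r.
  rewrite ltrBrDr => /le_lt_trans; apply.
  by rewrite (distrC y) -{1}(subrK y' a) -addrA ler_normD.
move=> a b /h ay /h bY; have [Ga rab] := rP _ _ ay bY; split=> //.
by rewrite (le_trans _ rab)// ler_wpM2r// gerBl.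
Qed.

Lemma lip_radius_gt0 (R : realType) (n : nat) (f : 'rV[R]_n -> 'rV[R]_n)
    (G : set 'rV[R]_n) (y : 'rV[R]_n) : nbhs y G ->
  (exists2 A, nbhs y A & [lipschitz f z | z in A]) -> 0 < lip_radius f G y.
Proof.
move=> Gy [A Ay [K [_ fK]]].
have [e /= e0 eGA] := (nbhs_ballP _ _).1 (filterI Gy Ay).
(* A radius that fits into [G] and the Lipschitz neighbourhood and whose
   inverse exceeds the Lipschitz constant. *)
pose k := `|K| + 1.
have k0 : 0 < k by rewrite ltr_pwDr.
have Kk : K < k by rewrite (le_lt_trans (ler_norm _))// ltrDl.
pose r := Num.min (Num.min e 1) k^-1.
have r0 : 0 < r by rewrite !lt_min e0 ltr01 invr_gt0.
apply: (lt_le_trans r0); apply: lip_radius_ge; split.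
  by rewrite (ltW r0)/= !ge_min lexx orbT.
have h a : `|a - y| < r -> (G `&` A) a.
  move=> ay; apply: eGA; rewrite mx_norm_ball /ball_/= distrC.
  by rewrite (lt_le_trans ay)// !ge_min lexx.
move=> a b /h[Ga Aa] /h[_ Ab]; split=> //.
have := fK _ Kk (a, b); rewrite /= => /(_ (conj Aa Ab)) fab.
rewrite (@le_trans _ _ (k^-1 * `|f a - f b|))//.
  by rewrite ler_wpM2r// !ge_min lexx !orbT.
by rewrite ler_pdivrMl.
Qed.

Lemma lip_radius_gt0_in (R : realType) (n : nat) (f : 'rV[R]_n -> 'rV[R]_n)
    (G : set 'rV[R]_n) (y : 'rV[R]_n) : 0 < lip_radius f G y -> G y.
Proof.
move=> /(sup_gt (lip_radii_has_sup f G y).1)[r [_ rP] r0].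
by have yr : `|y - y| < r; [rewrite subrr normr0|have [] := rP y y yr yr].
Qed.

Lemma lip_radius_dist (R : realType) (n : nat) (f : 'rV[R]_n -> 'rV[R]_n)
    (G : set 'rV[R]_n) (y y' : 'rV[R]_n) : `|y - y'| < lip_radius f G y ->
  lip_radius f G y * `|f y - f y'| <= `|y - y'|.
Proof.
move=> yy'; rewrite leNgt; apply/negP => h.
(* If the estimate failed, it would already fail for an admissible radius
   exceeding both the distance and the quotient below. *)
have D0 : 0 < `|f y - f y'|.
  rewrite normr_gt0; apply/negP => /eqP D; move: h.
  by rewrite D normr0 mulr0 ltNge normr_ge0.
have : Num.max `|y - y'| (`|y - y'| / `|f y - f y'|) < lip_radius f G y.
  by rewrite gt_max yy' ltr_pdivrMr.
move=> /(sup_gt (lip_radii_has_sup f G y).1)[r [/andP[r0 _] rP]].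
rewrite gt_max => /andP[ry rD].
have [||_] := rP y y'.
- by rewrite subrr normr0 (le_lt_trans _ ry).
- by rewrite distrC.
by apply/negP; rewrite -ltNge -ltr_pdivrMr.
Qed.

(** The point of [lip_radius]: between points closer than the
    radius, the radius compensates the Lipschitz constant of [f]; between points
    further apart, both values of the product are at most [M] times the
    distance. *)
Lemma lip_radius_scale_lipschitz (R : realType) (n : nat)
    (f : 'rV[R]_n -> 'rV[R]_n) (G : set 'rV[R]_n) (M : R) (y y' : 'rV[R]_n) :
  (forall x, `|f x| <= M) ->
  `|lip_radius f G y *: f y - lip_radius f G y' *: f y'| <=
    (2 * M + 1) * `|y - y'|.
Proof.
move=> fM; have M0 : 0 <= M := le_trans (normr_ge0 _) (fM 0).
wlog : y y' / lip_radius f G y' <= lip_radius f G y => [h|yy'].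
  have [/h//|/ltW /h] := leP (lip_radius f G y') (lip_radius f G y).
  by rewrite distrC [`|y' - y|]distrC.
have p0 := lip_radius_ge0 f G.
have [close|far] := ltP `|y - y'| (lip_radius f G y).
  rewrite (_ : _ - _ = lip_radius f G y *: (f y - f y') +
     (lip_radius f G y - lip_radius f G y') *: f y'); last first.
    by rewrite scalerBr scalerBl addrA subrK.
  rewrite (le_trans (ler_normD _ _))// !normrZ (ger0_norm (p0 y)).
  have h1 := lip_radius_dist close.
  have h2 : `|lip_radius f G y - lip_radius f G y'| * `|f y'| <= `|y - y'| * M.
    by rewrite ler_pM// ?fM// lip_radius_lipschitz.
  have : 0 <= `|y - y'| * M by rewrite mulr_ge0.
  lra.
rewrite (le_trans (ler_normB _ _))// !normrZ !ger0_norm//.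
have h1 : lip_radius f G y * `|f y| <= `|y - y'| * M by rewrite ler_pM.
have h2 : lip_radius f G y' * `|f y'| <= `|y - y'| * M.
  by rewrite ler_pM// (le_trans yy').
have := normr_ge0 (y - y').
lra.
Qed.

Definition solution_in (R : realType) (n : nat) (f : 'rV[R]_n -> 'rV[R]_n)
    (G : set 'rV[R]_n) (x0 : 'rV[R]_n) (T : R) (x : R -> 'rV[R]_n) : Prop :=
  [/\ 0 <= T, x 0 = x0, {within `[0, T], continuous x},
      (forall t : R, 0 < t < T -> is_derive t 1 x (f (x t))) &
      (forall t : R, 0 <= t < T -> G (x t))].

(** The slowed-down trajectory never reaches a zero of [lip_radius], since
    near such a zero its speed is at most [M] times the distance to it; hence it
    remains in [G]. *)
Lemma slow_solution (R : realType) (n : nat) (f : 'rV[R]_n -> 'rV[R]_n)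
    (G : set 'rV[R]_n) (x0 : 'rV[R]_n) (M : R) :
  0 < M -> (forall x, `|f x| <= M) -> open G ->
  (forall x, G x -> exists2 A, nbhs x A & [lipschitz f y | y in A]) ->
  G x0 ->
  exists z : R -> 'rV[R]_n, z 0 = x0 /\ (forall t : R, 0 <= t ->
    is_derive t 1 z (lip_radius f G (z t) *: f (z t)) /\
    0 < lip_radius f G (z t)).
Proof.
move=> M0 fM oG fG Gx0.
pose p := lip_radius f G.
have M1 : 0 < 2 * M + 1 by rewrite ltr_pwDr// mulr_ge0// ltW.
have [||z z0 dz] := @global_solution _ _ (fun x => p x *: f x) x0 (2 * M + 1) M
    M1.
- by move=> x y; exact: lip_radius_scale_lipschitz.
- move=> x; rewrite normrZ ger0_norm ?lip_radius_ge0//.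
  by rewrite -[leRHS]mul1r ler_pM// ?lip_radius_ge0// lip_radius_le1.
exists z; split=> // b b0; split; first exact: dz.
rewrite lt_def lip_radius_ge0 andbT; apply/eqP => pb.
have : 0 < p (z 0).
  rewrite z0 lip_radius_gt0//; first exact: open_nbhs_nbhs.
  exact: fG.
suff -> : z 0 = z b by rewrite /p pb ltxx.
apply: (@gronwall_cst _ _ z (fun t => p (z t) *: f (z t)) M b) => //.
- by move=> t /andP[t0 _]; exact: dz.
- move=> t _; rewrite normrZ ger0_norm ?lip_radius_ge0// mulrC ler_pM//.
    exact: lip_radius_ge0.
  have := lip_radius_lipschitz f G (z b) (z t).
  by rewrite pb sub0r normrN ger0_norm// lip_radius_ge0.
Qed.

(** The clock [tau] of the original field along the slowed-down trajectory
    [z] satisfies [tau' = lip_radius (z)], so [x = z \o tau^-1] solves [x' = f x]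
    until the time [T = sup tau], and extends to [T] because [f] is bounded. The
    limit is outside [G]: otherwise [tau'] would stay away from 0, and [tau]
    would be unbounded. *)
Theorem exit_solution (R : realType) (n : nat) (f : 'rV[R]_n -> 'rV[R]_n)
    (G : set 'rV[R]_n) (x0 : 'rV[R]_n) (M B : R) :
  0 < M -> (forall x, `|f x| <= M) -> open G ->
  (forall x, G x -> exists2 A, nbhs x A & [lipschitz f y | y in A]) ->
  G x0 ->
  (forall T x, solution_in f G x0 T x -> T <= B) ->
  exists T x, solution_in f G x0 T x /\ ~ G (x T).
Proof.
move=> M0 fM oG fG Gx0 solB.
have [z [z0 zP]] := slow_solution M0 fM oG fG Gx0.
pose p := lip_radius f G.
have p0 s : 0 <= p s by exact: lip_radius_ge0.
have pz (s : R) : 0 <= s -> 0 < p (z s) by move=> /zP[].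
have dz (s : R) : 0 <= s -> is_derive s 1 z (p (z s) *: f (z s)) by move=>
    /zP[].
have [tau tau0 dtau'] : exists2 tau : R -> R, tau 0 = 0 &
    forall t : R, 0 <= t -> is_derive t 1 tau (p (z `|t|)).
  apply: primitive => s.
  apply: (@continuous_comp _ _ _ (fun s : R => z `|s|) p); last first.
    apply: (@lipschitz_continuous _ _ _ _ 1) => x y.
    by rewrite mul1r lip_radius_lipschitz.
  apply: (@continuous_comp _ _ _ (fun s : R => `|s|) z).
    exact: norm_continuous.
  exact: is_derive_continuous (dz _ (normr_ge0 s)).
have dtau (t : R) : 0 <= t -> is_derive t 1 tau (p (z t)).
  by move=> t0; have := dtau' t t0; rewrite ger0_norm.
have ctau (s t : R) : 0 <= s -> {within `[s, t], continuous tau}.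
  move=> s0; apply: derivable_within_continuous => u; rewrite in_itv/= =>
      /andP[su _].
  by have [] := dtau u (le_trans s0 su).
have cz (s t : R) : 0 <= s -> {within `[s, t], continuous z}.
  move=> s0; apply: derivable_within_continuous => u; rewrite in_itv/= =>
      /andP[su _].
  by have [] := dz u (le_trans s0 su).
have tau_lt (s t : R) : 0 <= s -> s < t -> tau s < tau t.
  move=> s0 st; apply: (@gtr0_derive1_lt_cc _ tau s t) => //.
  - move=> u; rewrite in_itv/= => /andP[/ltW su _].
    by have [] := dtau u (le_trans s0 su).
  - move=> u; rewrite in_itv/= => /andP[/ltW su _].
    have su0 := le_trans s0 su.
    by rewrite derive1E; have [_ ->] := dtau u su0; exact: pz.
  - exact: ctau.
  - by rewrite in_itv/= lexx ltW.
  - by rewrite in_itv/= lexx ltW.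
have tau_le (s t : R) : 0 <= s -> s <= t -> tau s <= tau t.
  by move=> s0; rewrite le_eqVlt => /predU1P[->//|/(tau_lt _ _ s0)/ltW].
have tau_ge0 (s : R) : 0 <= s -> 0 <= tau s.
  by move=> s0; rewrite -tau0 tau_le.
have ztau (s t : R) : 0 <= s -> s <= t -> `|z t - z s| <= M * (tau t - tau s).
  move=> s0 st; rewrite mulrBr.
  apply: (@derive_norm_le _ _ z (fun u => p (z u) *: f (z u))
    (fun u => M * tau u) (fun u => M * p (z u))) => //.
  - exact: cz.
  - move=> x; apply: (@cvgM _ (subspace `[s, t]%classic)); first exact: cvg_cst.
    exact: ctau.
  - by move=> u /andP[/ltW su _]; apply: dz; apply: le_trans su.
  - move=> u /andP[/ltW su _]; have := dtau u (le_trans s0 su) => du.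
    by apply: is_derive_eq; rewrite /GRing.scale /=; ring.
  - by move=> u _; rewrite normrZ ger0_norm// mulrC ler_wpM2r.
have tau_surj (t s : R) : 0 <= s -> 0 <= t <= tau s -> exists2 u, 0 <= u <= s &
    tau u = t.
  move=> s0 ts.
  have [|u] := @IVT _ tau 0 s t s0 (ctau _ _ (lexx 0)).
    by rewrite tau0 min_l ?tau_ge0// max_r ?tau_ge0.
  by rewrite in_itv/= => us ut; exists u.
have /choice[sig sigP] (t : R) : exists s, (exists2 u, 0 <= u & tau u = t) ->
    0 <= s /\ tau s = t.
  have [[u u0 ut]|h] := pselect (exists2 u, 0 <= u & tau u = t); first by
      exists u.
  by exists 0 => /h.
have sigK (s : R) : 0 <= s -> sig (tau s) = s.
  move=> s0; have [|u0 us] := sigP (tau s); first by exists s.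
  case: (ltgtP (sig (tau s)) s) => // [/(tau_lt _ _ u0)|/(tau_lt _ _ s0)];
    by rewrite us ltxx.
have dx (s : R) : 0 < s -> is_derive (tau s) 1 (fun t => z (sig t)) (f (z s)).
  move=> s0.
  have dsig : is_derive (tau s) 1 sig (p (z s))^-1.
    apply: is_derive_inverse.
    - near=> u; apply: sigK; apply: ltW; near: u; exact: lt_nbhsr.
    - near=> u; apply: is_derive_continuous; apply: dtau; apply: ltW.
      by near: u; exact: lt_nbhsr.
    - exact/dtau/ltW.
    - by rewrite gt_eqF// pz// ltW.
  apply/is_derive_rVP => i.
  have dzi : is_derive (sig (tau s)) 1 (fun u => z u 0 i) ((p (z s) *: f (z s))
      0 i).
    by rewrite sigK ?ltW//; apply: (is_derive_rVP _ _ _ _).1; exact/dz/ltW.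
  have -> : f (z s) 0 i = (p (z s) *: f (z s)) 0 i * (p (z s))^-1.
    by rewrite mxE mulrAC divff ?mul1r// gt_eqF// pz// ltW.
  exact: (@is_derive1_comp _ (fun u => z u 0 i) sig).
have tauB (s : R) : 0 <= s -> tau s <= B.
  move=> s0; apply: (solB _ (fun t => z (sig t))); split.
  - exact: tau_ge0.
  - by rewrite -tau0 sigK.
  - apply: (@within_lipschitz_continuous _ R _ _ _ M) => t u.
    rewrite /= !in_itv/= => /(tau_surj _ _ s0)[t' /andP[t'0 _] <-].
    move=> /(tau_surj _ _ s0)[u' /andP[u'0 _] <-].
    rewrite !sigK//.
    have [tu|/ltW tu] := leP t' u'.
      by rewrite distrC [X in _ * X]distrC [`|tau _ - _|]ger0_norm ?subr_ge0
          ?tau_le// ztau.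
    by rewrite [`|tau _ - _|]ger0_norm ?subr_ge0 ?tau_le// ztau.
  - move=> t /andP[t0 ts].
    have [|u /andP[u0 us] ut] := tau_surj t s s0; first by rewrite !ltW.
    rewrite -ut sigK//; apply: dx; rewrite lt_neqAle u0 andbT.
    by apply/eqP => u0'; move: t0; rewrite -ut -u0' tau0 ltxx.
  - move=> t /andP[t0 ts].
    have [|u /andP[u0 us] <-] := tau_surj t s s0; first by rewrite t0 ltW.
    by rewrite sigK//; apply: lip_radius_gt0_in; exact: pz.
pose S := tau @` [set s | 0 <= s].
have supS : has_sup S.
  split; first by exists (tau 0), 0 => /=.
  by exists B => _ [s s0 <-]; exact: tauB.
pose T := sup S.
have tauT (s : R) : 0 <= s -> tau s < T.
  move=> s0; apply: (@lt_le_trans _ _ (tau (s + 1))).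
    by apply: tau_lt => //; rewrite ltrDl.
  by apply: sup_upper_bound => //; exists (s + 1) => //=; rewrite addr_ge0.
have Ttau (t : R) : t < T -> exists2 s, 0 <= s & t < tau s.
  by move=> /(sup_gt supS.1)[_ [s s0 <-] ts]; exists s.
have T0 : 0 < T by rewrite -tau0 tauT.
have surjT (t : R) : 0 <= t < T -> exists2 s, 0 <= s & tau s = t.
  move=> /andP[t0 /Ttau[s s0 ts]].
  have [|u /andP[u0 _] ut] := tau_surj t s s0; first by rewrite t0 ltW.
  by exists u.
have [||zT zTP] := @cauchy_bound_lim _ _ (fun k => z k%:R) (fun k => M * (T -
    tau k%:R)).
- rewrite -(mulr0 M); apply: cvgM; first exact: cvg_cst.
  rewrite -(subrr T); apply: cvgB; first exact: cvg_cst.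
  apply/cvgrPdist_le => e e0.
  have [s s0 ts] : exists2 s, 0 <= s & T - e < tau s by apply: Ttau; rewrite
      gtrBl.
  exists (Num.bound s) => // k /= sk.
  rewrite ger0_norm ?subr_ge0 ?ltW ?tauT//.
  have sk' : s <= k%:R.
    rewrite (le_trans (ltW (archi_boundP s0)))//.
    by rewrite ler_nat.
  by rewrite ltrBlDl -ltrBlDr (lt_le_trans ts)// tau_le.
- move=> k m km; apply: (le_trans (ztau _ _ _ _)) => //; first by rewrite
      ler_nat.
  by rewrite ler_pM2l// lerB// ltW// tauT.
have zTs (s : R) : 0 <= s -> `|zT - z s| <= M * (T - tau s).
  move=> s0; pose k := Num.bound s.
  have sk : s <= k%:R := ltW (archi_boundP s0).
  have h1 := zTP k.
  have h2 := ztau _ _ s0 sk.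
  rewrite -(subrK (z k%:R) zT) -addrA (le_trans (ler_normD _ _))//.
  by rewrite (le_trans (lerD h1 h2))// -mulrDr addrA subrK.
(* [zT] is the limit of [z] at infinity. *)
pose x t := if t < T then z (sig t) else zT.
have xtau (s : R) : 0 <= s -> x (tau s) = z s by move=> s0; rewrite /x tauT//
    sigK.
have xT : x T = zT by rewrite /x ltxx.
exists T, x; split; last first.
  rewrite xT => GzT.
  have c0 : 0 < p zT.
    by rewrite lip_radius_gt0//; [exact: open_nbhs_nbhs|exact: fG].
  have [s s0 ts] : exists2 s, 0 <= s & T - p zT / 2 / M < tau s.
    by apply: Ttau; rewrite gtrBl !divr_gt0.
  have pc (u : R) : s <= u -> p zT / 2 <= p (z u).
    move=> su; have u0 := le_trans s0 su.
    have h1 := lip_radius_lipschitz f G zT (z u).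
    have h2 := zTs u u0.
    have h3 : M * (T - tau u) <= p zT / 2.
      rewrite -ler_pdivlMl// mulrC lerBlDl -lerBlDr (le_trans (ltW ts))//.
      exact: tau_le.
    have := le_trans (le_trans (ler_norm _) h1) (le_trans h2 h3).
    by rewrite -/p; lra.
  (* Running with [tau' >= p zT / 2] from [s] on, the clock would pass [T] by
     time [u]. *)
  pose u := s + (T - tau s) / (p zT / 2).
  have su : s <= u.
    by rewrite lerDl divr_ge0 ?subr_ge0// ltW// ?tauT// divr_gt0.
  have : tau s - p zT / 2 * s <= tau u - p zT / 2 * u.
    apply: (@derive_ge0_le _ (fun v => tau v - p zT / 2 * v) (fun v => p (z v)
        - p zT / 2)) => //.
    - apply: derivable_within_continuous => v; rewrite in_itv/= => /andP[sv _].
      apply: derivableB; first by have [] := dtau v (le_trans s0 sv).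
      exact: derivableM.
    - move=> v /andP[/ltW sv _]; have := dtau v (le_trans s0 sv) => dv.
      by apply: is_derive_eq; rewrite /GRing.scale /=; ring.
    - by move=> v /andP[/ltW sv _]; rewrite subr_ge0 pc.
  have -> : p zT / 2 * u = p zT / 2 * s + (T - tau s).
    by rewrite /u; field; rewrite gt_eqF.
  have := tauT u (le_trans s0 su).
  lra.
have xlip (s t : R) : 0 <= s -> s <= t -> t <= T -> `|x t - x s| <= M * (t - s).
  move=> s0 st; rewrite le_eqVlt => /predU1P[tT|tT].
    rewrite tT xT; have [sT|Ts] := ltP s T; last first.
      have -> : s = T by apply/eqP; rewrite eq_le Ts andbT -tT.
      by rewrite xT !subrr normr0 mulr0.
    have [|s' s'0 <-] := surjT s; first by rewrite s0 sT.
    by rewrite xtau// zTs.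
  have [|s' s'0 ss'] := surjT s; first by rewrite s0 (le_lt_trans st).
  have [|t' t'0 tt'] := surjT t; first by rewrite (le_trans s0 st).
  rewrite -ss' -tt' !xtau// ztau//.
  rewrite leNgt; apply/negP => /(tau_lt _ _ t'0).
  by rewrite ss' tt' ltNge st.
split.
- exact: ltW.
- by rewrite -tau0 xtau.
- apply: (@within_lipschitz_continuous _ R _ _ _ M) => t u.
  rewrite /= !in_itv/= => /andP[t0 tT] /andP[u0 uT].
  have [tu|/ltW tu] := leP t u.
    by rewrite distrC [X in _ * X]distrC [`|u - t|]ger0_norm ?subr_ge0// xlip.
  by rewrite [`|t - u|]ger0_norm ?subr_ge0// xlip.
- move=> t /andP[t0 tT].
  have [|s s0 st] := surjT t; first by rewrite ltW.
  have s1 : 0 < s.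
    rewrite lt_neqAle s0 andbT.
    by apply/eqP => s0'; move: t0; rewrite -st -s0' tau0 ltxx.
  rewrite -st xtau//.
  apply: near_eq_is_derive (dx s s1).
  near=> u; rewrite /x ifT//; near: u.
  by apply: lt_nbhsl; rewrite st.
- move=> t tT; have [s s0 <-] := surjT t tT.
  by rewrite xtau//; apply: lip_radius_gt0_in; exact: pz.
Unshelve. all: by end_near. Qed.

(** * Euclidean geometry *)

Lemma dotC (R : realType) (n : nat) (u v : 'rV[R]_n) : dot u v = dot v u.
Proof. by apply: eq_bigr => i _; rewrite mulrC. Qed.

Lemma dotDl (R : realType) (n : nat) (u v w : 'rV[R]_n) :
  dot (u + v) w = dot u w + dot v w.
Proof. by rewrite /dot -big_split; apply: eq_bigr => i _; rewrite mxE mulrDl.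
    Qed.

Lemma dotZl (R : realType) (n : nat) (k : R) (u v : 'rV[R]_n) :
  dot (k *: u) v = k * dot u v.
Proof. by rewrite /dot mulr_sumr; apply: eq_bigr => i _; rewrite mxE mulrA. Qed.

Lemma dotBl (R : realType) (n : nat) (u v w : 'rV[R]_n) :
  dot (u - v) w = dot u w - dot v w.
Proof. by rewrite dotDl -scaleN1r dotZl mulN1r. Qed.

Lemma dotDr (R : realType) (n : nat) (u v w : 'rV[R]_n) :
  dot u (v + w) = dot u v + dot u w.
Proof. by rewrite dotC dotDl !(dotC _ u). Qed.

Lemma dotZr (R : realType) (n : nat) (k : R) (u v : 'rV[R]_n) :
  dot u (k *: v) = k * dot u v.
Proof. by rewrite dotC dotZl dotC. Qed.

Lemma dotBr (R : realType) (n : nat) (u v w : 'rV[R]_n) :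
  dot u (v - w) = dot u v - dot u w.
Proof. by rewrite dotC dotBl !(dotC _ u). Qed.

Lemma dot0l (R : realType) (n : nat) (u : 'rV[R]_n) : dot 0 u = 0.
Proof. by rewrite -(scale0r u) dotZl mul0r. Qed.

Lemma dot_ge0 (R : realType) (n : nat) (u : 'rV[R]_n) : 0 <= dot u u.
Proof. by apply: sumr_ge0 => i _; rewrite -expr2 sqr_ge0. Qed.

Lemma enorm_ge0 (R : realType) (n : nat) (u : 'rV[R]_n) : 0 <= enorm u.
Proof. exact: sqrtr_ge0. Qed.

Lemma enorm_sqr (R : realType) (n : nat) (u : 'rV[R]_n) :
  enorm u ^+ 2 = dot u u.
Proof. by rewrite sqr_sqrtr// dot_ge0. Qed.

Lemma normr_le_enorm (R : realType) (n : nat) (u : 'rV[R]_n) :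
  `|u| <= enorm u.
Proof.
apply: normr_rV_le => [|i]; first exact: enorm_ge0.
rewrite -sqrtr_sqr ler_sqrt ?dot_ge0// /dot (bigD1 i)//= -expr2 lerDl.
by apply: sumr_ge0 => j _; rewrite -expr2 sqr_ge0.
Qed.

Lemma enorm0 (R : realType) (n : nat) : enorm (0 : 'rV[R]_n) = 0.
Proof. by rewrite /enorm dot0l sqrtr0. Qed.

Lemma enorm_eq0 (R : realType) (n : nat) (u : 'rV[R]_n) :
  (enorm u == 0) = (u == 0).
Proof.
apply/eqP/eqP => [u0|->]; last exact: enorm0.
by apply/eqP; rewrite -normr_le0 -u0 normr_le_enorm.
Qed.

Lemma enorm_gt0 (R : realType) (n : nat) (u : 'rV[R]_n) :
  (0 < enorm u) = (u != 0).
Proof. by rewrite lt_def enorm_ge0 andbT enorm_eq0. Qed.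

Lemma enormZ (R : realType) (n : nat) (k : R) (u : 'rV[R]_n) :
  enorm (k *: u) = `|k| * enorm u.
Proof.
by rewrite /enorm dotZl dotZr mulrA -expr2 sqrtrM ?sqr_ge0// sqrtr_sqr.
Qed.

Lemma enormN (R : realType) (n : nat) (u : 'rV[R]_n) : enorm (- u) = enorm u.
Proof. by rewrite -scaleN1r enormZ normrN1 mul1r. Qed.

Lemma cauchy_schwarz (R : realType) (n : nat) (u v : 'rV[R]_n) :
  dot u v <= enorm u * enorm v.
Proof.
have [->|u0] := eqVneq u 0; first by rewrite dot0l enorm0 mul0r.
have [->|v0] := eqVneq v 0; first by rewrite dotC dot0l enorm0 mulr0.
have := dot_ge0 (enorm v *: u - enorm u *: v).
rewrite !(dotBl, dotBr, dotZl, dotZr) (dotC v u) -!enorm_sqr.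
set a := enorm u; set b := enorm v => h.
have a0 : 0 < a by rewrite enorm_gt0.
have b0 : 0 < b by rewrite enorm_gt0.
have ab : 0 < a * b by rewrite mulr_gt0.
rewrite -(ler_pM2l ab); lra.
Qed.

Lemma enormD (R : realType) (n : nat) (u v : 'rV[R]_n) :
  enorm (u + v) <= enorm u + enorm v.
Proof.
rewrite -(@ler_pXn2r _ 2)// ?nnegrE ?addr_ge0 ?enorm_ge0//.
rewrite sqrrD !enorm_sqr !(dotDl, dotDr) (dotC v u).
have := cauchy_schwarz u v; lra.
Qed.

Lemma enorm_delta (R : realType) (n : nat) (i : 'I_n) :
  enorm (delta_mx 0 i : 'rV[R]_n) = 1.
Proof.
rewrite /enorm /dot (bigD1 i)//= big1 => [|j ji].
  by rewrite !mxE !eqxx addr0 mulr1 sqrtr1.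
by rewrite !mxE (negbTE ji) mulr0.
Qed.

Lemma is_derive_dot (R : realType) (V : normedModType R) (n : nat)
    (w w' : V -> 'rV[R]_n) (dw dw' : 'rV[R]_n) (x h : V) :
  is_derive x h w dw -> is_derive x h w' dw' ->
  is_derive x h (fun y => dot (w y) (w' y)) (dot (w x) dw' + dot dw (w' x)).
Proof.
move=> /is_derive_rVP wd /is_derive_rVP wd'.
rewrite /dot -big_split/=.
rewrite (_ : (fun y => _) = \sum_(i < n) (fun y => w y 0 i * w' y 0 i)); last
    first.
  by apply/funext => y; rewrite fct_sumE.
apply: is_derive_sum => i.
have h1 := wd i; have h2 := wd' i.
apply: is_derive_eq.
by rewrite /GRing.scale /=; ring.
Qed.

Lemma is_derive_enorm (R : realType) (V : normedModType R) (n : nat)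
    (w : V -> 'rV[R]_n) (dw : 'rV[R]_n) (x h : V) :
  w x != 0 -> is_derive x h w dw ->
  is_derive x h (fun y => enorm (w y)) (dot (w x) dw / enorm (w x)).
Proof.
move=> wx wd; rewrite /enorm.
have d0 : 0 < dot (w x) (w x) by rewrite -enorm_sqr exprn_gt0// enorm_gt0.
have := @is_derive_comp1 _ _ Num.sqrt (fun y => dot (w y) (w y)) _ _ x h
  (is_derive1_sqrt d0) (is_derive_dot wd wd).
rewrite (_ : _ * _ = dot (w x) dw / Num.sqrt (dot (w x) (w x)))//.
rewrite (dotC dw); field.
by rewrite gt_eqF// sqrtr_gt0.
Qed.

Lemma dot_delta (R : realType) (n : nat) (u : 'rV[R]_n) (i : 'I_n) :
  dot u (delta_mx 0 i) = u 0 i.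
Proof.
rewrite /dot (bigD1 i)//= big1 => [|j ji].
  by rewrite !mxE !eqxx addr0 mulr1.
by rewrite !mxE (negbTE ji) andbF mulr0.
Qed.

Lemma differentiable_enorm (R : realType) (n : nat) (u : 'rV[R]_n) :
  u != 0 -> differentiable (@enorm R n) u.
Proof.
move=> u0; apply: (@differentiable_comp _ _ _ _ (fun v : 'rV[R]_n => dot v v)
    Num.sqrt).
  rewrite (_ : (fun v => dot v v) = \sum_(i < n) (fun v : 'rV[R]_n => v 0 i * v
      0 i)).
    apply: differentiable_sum => i.
    by apply: differentiableM; exact: differentiable_coord.
  by apply/funext => v; rewrite fct_sumE.
apply/derivable1_diffP.
have d0 : 0 < dot u u by rewrite -enorm_sqr exprn_gt0// enorm_gt0.
by have [] := is_derive1_sqrt d0.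
Qed.

(** * Calculus of locally Lipschitz maps *)

(** The regularity that [feedback] requires at a non-terminal state. *)
Definition lip_at (R : realType) (V W : normedModType R) (f : V -> W)
    (x : V) : Prop :=
  exists2 A : set V, nbhs x A & [lipschitz f y | y in A].

Lemma lip_atP (R : realType) (V W : normedModType R) (f : V -> W) (x : V) :
  lip_at f x <-> exists k, 0 <= k /\ exists2 A : set V, nbhs x A &
    forall y z, A y -> A z -> `|f y - f z| <= k * `|y - z|.
Proof.
split=> [[A xA [K [_ fK]]]|[k [k0 [A xA fk]]]].
  exists (`|K| + 1); split; first by rewrite addr_ge0.
  exists A => // y z Ay Az; have Kk : K < `|K| + 1.
    by rewrite (le_lt_trans (ler_norm _))// ltrDl.
  exact: (fK _ Kk (y, z)).
exists A => //; exists k; split; first exact: num_real.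
move=> K kK [y z] [/= Ay Az].
by rewrite (le_trans (fk _ _ Ay Az))// ler_wpM2r// ltW.
Qed.

Lemma lip_at_lipschitz (R : realType) (V W : normedModType R) (f : V -> W)
    (k : R) (x : V) : (forall y z, `|f y - f z| <= k * `|y - z|) -> lip_at f x.
Proof.
move=> fk; apply/lip_atP; exists `|k|; split=> //; exists setT => [|y z _ _].
  exact: filterT.
by rewrite (le_trans (fk _ _))// ler_wpM2r// ler_norm.
Qed.

Lemma lip_at_continuous (R : realType) (V W : normedModType R) (f : V -> W)
    (x : V) : lip_at f x -> {for x, continuous f}.
Proof.
move=> /lip_atP[k [k0 [A xA fk]]]; apply/cvgrPdist_le => e e0.
have k1 : 0 < k + 1 by rewrite ltr_pwDr.
have Ax := nbhs_singleton xA.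
near=> y; have Ay : A y by near: y.
apply: (le_trans (fk x y Ax Ay)).
apply: (@le_trans _ _ ((k + 1) * `|x - y|)).
  by apply: ler_wpM2r => //; rewrite lerDl.
rewrite mulrC -ler_pdivlMr//; near: y.
by apply: (@cvgr_dist_le _ _ _ _ _ id); [exact: cvg_id|rewrite divr_gt0].
Unshelve. all: by end_near. Qed.

Lemma lip_at_near (R : realType) (V W : normedModType R) (f g : V -> W)
    (x : V) : (\near x, f x = g x) -> lip_at f x -> lip_at g x.
Proof.
move=> fg /lip_atP[k [k0 [A xA fk]]]; apply/lip_atP; exists k; split=> //.
exists (A `&` [set y | f y = g y]); first exact: filterI.
by move=> y z [Ay <-] [Az <-]; exact: fk.
Qed.

Lemma lip_at_comp (R : realType) (U V W : normedModType R) (f : U -> V)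
    (g : V -> W) (x : U) : lip_at f x -> lip_at g (f x) ->
  lip_at (fun y => g (f y)) x.
Proof.
move=> /[dup] /lip_at_continuous cf /lip_atP[k [k0 [A xA fk]]].
move=> /lip_atP[l [l0 [B fxB gl]]]; apply/lip_atP.
exists (l * k); split; first exact: mulr_ge0.
exists (A `&` f @^-1` B); first by apply: filterI => //; exact: cf.
move=> y z [Ay By] [Az Bz].
by rewrite (le_trans (gl _ _ By Bz))// -mulrA ler_wpM2l// fk.
Qed.

Lemma lip_at_cst (R : realType) (V W : normedModType R) (w : W) (x : V) :
  lip_at (fun _ => w) x.
Proof.
by apply: (@lip_at_lipschitz _ _ _ _ 0) => y z; rewrite subrr normr0 mul0r.
Qed.

Lemma lip_at_id (R : realType) (V : normedModType R) (x : V) :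
  lip_at (fun y => y) x.
Proof. by apply: (@lip_at_lipschitz _ _ _ _ 1) => y z; rewrite mul1r. Qed.

Lemma lip_atD (R : realType) (V W : normedModType R) (f g : V -> W) (x : V) :
  lip_at f x -> lip_at g x -> lip_at (fun y => f y + g y) x.
Proof.
move=> /lip_atP[k [k0 [A xA fk]]] /lip_atP[l [l0 [B xB gl]]]; apply/lip_atP.
exists (k + l); split; first exact: addr_ge0.
exists (A `&` B); first exact: filterI.
move=> y z [Ay By] [Az Bz]; rewrite opprD addrACA mulrDl.
by rewrite (le_trans (ler_normD _ _))// lerD ?fk ?gl.
Qed.

Lemma lip_atN (R : realType) (V W : normedModType R) (f : V -> W) (x : V) :
  lip_at f x -> lip_at (fun y => - f y) x.
Proof.
move=> /lip_atP[k [k0 [A xA fk]]]; apply/lip_atP.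
exists k; split=> //; exists A => // y z Ay Az.
by rewrite -opprD normrN fk.
Qed.

Lemma lip_atB (R : realType) (V W : normedModType R) (f g : V -> W) (x : V) :
  lip_at f x -> lip_at g x -> lip_at (fun y => f y - g y) x.
Proof. by move=> fx gx; apply: lip_atD => //; exact: lip_atN. Qed.

Lemma lip_at_bounded (R : realType) (V W : normedModType R) (f : V -> W)
    (x : V) : lip_at f x -> \forall y \near x, `|f y| <= `|f x| + 1.
Proof.
move=> /lip_at_continuous /cvgrPdist_le /(_ 1 ltr01); apply: filterS => y h.
by rewrite -(subrK (f x) (f y)) addrC (le_trans (ler_normD _ _))// lerD2l
    distrC.
Qed.

Lemma lip_atZ (R : realType) (V W : normedModType R) (f : V -> R) (g : V -> W)
    (x : V) : lip_at f x -> lip_at g x -> lip_at (fun y => f y *: g y) x.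
Proof.
move=> /[dup] /lip_at_bounded fb /lip_atP[k [k0 [A xA fk]]].
move=> /[dup] /lip_at_bounded gb /lip_atP[l [l0 [B xB gl]]]; apply/lip_atP.
exists ((`|f x| + 1) * l + k * (`|g x| + 1)); split.
  by rewrite addr_ge0// mulr_ge0// addr_ge0.
exists ((A `&` [set y | `|f y| <= `|f x| + 1]) `&`
        (B `&` [set y | `|g y| <= `|g x| + 1])).
  by apply: filterI; exact: filterI.
move=> y z [[Ay fy] [By gy]] [[Az fz] [Bz gz]].
rewrite (_ : _ - _ = f y *: (g y - g z) + (f y - f z) *: g z); last first.
  by rewrite scalerBr scalerBl addrA subrK.
rewrite (le_trans (ler_normD _ _))// !normrZ mulrDl; apply: lerD.
  by rewrite -mulrA ler_pM// gl.
by rewrite mulrAC ler_pM// fk.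
Qed.

Lemma lip_atM (R : realType) (V : normedModType R) (f g : V -> R)
    (x : V) : lip_at f x -> lip_at g x -> lip_at (fun y => f y * g y) x.
Proof. exact: lip_atZ. Qed.

Lemma lip_at_inv (R : realType) (r : R) : r != 0 -> lip_at (@GRing.inv R) r.
Proof.
move=> r0; have r1 : 0 < `|r| / 2 by rewrite divr_gt0// normr_gt0.
apply/lip_atP; exists ((`|r| / 2) ^- 2); split; first by rewrite invr_ge0
    exprn_ge0// ltW.
exists (ball r (`|r| / 2)); first exact: nbhsx_ballx.
have h (s : R) : ball r (`|r| / 2) s -> `|r| / 2 <= `|s|.
  rewrite /ball /= => rs; have := le_lt_trans (ler_dist_dist _ _) rs.
  by move=> /(le_lt_trans (ler_norm _)); lra.
move=> y z /h yr /h zr.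
have y0 : y != 0 by rewrite -normr_gt0 (lt_le_trans r1).
have z0 : z != 0 by rewrite -normr_gt0 (lt_le_trans r1).
rewrite (_ : y^-1 - z^-1 = (y * z)^-1 * (z - y)); last by field; rewrite y0 z0.
rewrite normrM (distrC z) ler_wpM2r// normfV lef_pV2 ?posrE ?exprn_gt0//.
  by rewrite normrM expr2 ler_pM// ltW.
by rewrite normr_gt0 mulf_neq0.
Qed.

Lemma lip_at_sqrt (R : realType) (r : R) : 0 < r -> lip_at (@Num.sqrt R) r.
Proof.
move=> r0; have s0 : 0 < Num.sqrt (r / 2) by rewrite sqrtr_gt0 divr_gt0.
apply/lip_atP; exists (Num.sqrt (r / 2))^-1; split; first by rewrite invr_ge0
    ltW.
exists (ball r (r / 2)); first by apply: nbhsx_ballx; rewrite divr_gt0.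
have h (s : R) : ball r (r / 2) s -> r / 2 <= s.
  by rewrite /ball /= => /(le_lt_trans (ler_norm _)); lra.
have r2 : 0 <= r / 2 by rewrite divr_ge0// ltW.
move=> y z /h yr /h zr.
have y0 := le_trans r2 yr; have z0 := le_trans r2 zr.
have yr' : Num.sqrt (r / 2) <= Num.sqrt y by rewrite ler_sqrt.
rewrite ler_pdivlMl//.
rewrite -{2}(sqr_sqrtr y0) -{2}(sqr_sqrtr z0) subr_sqr normrM mulrC ler_wpM2l//.
rewrite (le_trans yr')// ger0_norm ?addr_ge0 ?sqrtr_ge0//.
by rewrite lerDl sqrtr_ge0.
Qed.

Lemma lip_at_norm (R : realType) (V : normedModType R) (x : V) :
  lip_at (fun y : V => `|y|) x.
Proof.
apply: (@lip_at_lipschitz _ _ R _ 1) => y z; rewrite mul1r.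
exact: ler_dist_dist.
Qed.

Lemma lip_at_max (R : realType) (V : normedModType R) (f g : V -> R) (x : V) :
  lip_at f x -> lip_at g x -> lip_at (fun y => Num.max (f y) (g y)) x.
Proof.
move=> fx gx.
rewrite (_ : (fun y => _) = (fun y => (f y + g y + `|f y - g y|) * 2^-1)).
  apply: lip_atM; last exact: lip_at_cst.
  apply: lip_atD; first exact: lip_atD.
  apply: (@lip_at_comp _ _ R R (fun y => f y - g y)); first exact: lip_atB.
  exact: lip_at_norm.
apply/funext => y; have [h|h] := leP (f y) (g y).
  by rewrite ler0_norm ?subr_le0//; lra.
by rewrite gtr0_norm ?subr_gt0//; lra.
Qed.

Lemma lip_at_coord (R : realType) (V : normedModType R) (n : nat)
    (f : V -> 'rV[R]_n) (i : 'I_n) (x : V) :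
  lip_at f x -> lip_at (fun y => f y 0 i) x.
Proof.
move=> fx; apply: (@lip_at_comp _ _ _ R f (fun v : 'rV[R]_n => v 0 i)) => //.
apply: (@lip_at_lipschitz _ _ R _ 1) => y z; rewrite mul1r.
by have := normr_coord_le (y - z) i; rewrite !mxE.
Qed.

Lemma lip_at_sum (R : realType) (V W : normedModType R) (I : Type) (r : seq I)
    (f : I -> V -> W) (x : V) :
  (forall i, lip_at (f i) x) -> lip_at (fun y => \sum_(i <- r) f i y) x.
Proof.
move=> fx; elim: r => [|i r ih].
  by under eq_fun do rewrite big_nil; exact: lip_at_cst.
by under eq_fun do rewrite big_cons; exact: lip_atD.
Qed.

Lemma lip_at_dot (R : realType) (V : normedModType R) (n : nat)
    (f g : V -> 'rV[R]_n) (x : V) :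
  lip_at f x -> lip_at g x -> lip_at (fun y => dot (f y) (g y)) x.
Proof.
by move=> fx gx; apply: lip_at_sum => i; apply: lip_atM; exact: lip_at_coord.
Qed.

Lemma lip_at_enorm (R : realType) (V : normedModType R) (n : nat)
    (f : V -> 'rV[R]_n) (x : V) :
  lip_at f x -> f x != 0 -> lip_at (fun y => enorm (f y)) x.
Proof.
move=> fx fx0; apply: (@lip_at_comp _ _ R R (fun y => dot (f y) (f y))).
  exact: lip_at_dot.
by apply: lip_at_sqrt; rewrite -enorm_sqr exprn_gt0// enorm_gt0.
Qed.

Lemma continuous_dot_diag (R : realType) (n : nat) :
  continuous (fun u : 'rV[R]_n => dot u u).
Proof.
move=> u; apply: lip_at_continuous.
by apply: lip_at_dot; exact: lip_at_id.
Qed.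

Lemma continuous_enorm (R : realType) (n : nat) :
  continuous (@enorm R n).
Proof.
move=> u; apply: (@continuous_comp _ _ _ (fun u => dot u u) Num.sqrt).
  exact: continuous_dot_diag.
exact: sqrt_continuous.
Qed.

(** * States of the game *)

Lemma lip_at_fst (R : realType) (x : state R) : lip_at (fun y : state R => y.1)
    x.
Proof.
apply: (@lip_at_lipschitz _ _ _ _ 1) => y z; rewrite mul1r.
by rewrite [leRHS]/Num.Def.normr /= le_max lexx.
Qed.

Lemma lip_at_snd (R : realType) (x : state R) : lip_at (fun y : state R => y.2)
    x.
Proof.
apply: (@lip_at_lipschitz _ _ _ _ 1) => y z; rewrite mul1r.
by rewrite [leRHS]/Num.Def.normr /= le_max lexx orbT.
Qed.

Lemma nonterminalP (R : realType) (x : state R) :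
  ~ terminal x <-> x.1 != 0 /\ x.1 != x.2.
Proof.
split=> [nt|[x0 x12] [/eqP|[/eqP]]]; rewrite ?(negbTE x0)//; last first.
  by rewrite eq_sym (negbTE x12).
have x0 : x.1 != 0 by apply/eqP => x0; apply: nt; left.
split=> //; apply/eqP => x12; apply: nt; right; split=> //.
exact/eqP.
Qed.

Lemma near_distinct (R : realType) (x : state R) : x.1 != x.2 ->
  \forall y \near x, y.1 != y.2.
Proof.
move=> x12; have : \forall y \near x, y.1 - y.2 != 0.
  apply: (@near_neq0 _ _ _ (fun y : state R => y.1 - y.2)); last by rewrite
      subr_eq0.
  by apply: cvgB; [exact: cvg_fst|exact: cvg_snd].
by apply: filterS => y; rewrite subr_eq0.
Qed.

Lemma open_nonterminal (R : realType) :
  open [set x : state R | ~ terminal x].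
Proof.
rewrite openE => x /nonterminalP[x0 /near_distinct x12].
have h1 : \forall y \near x, y.1 != 0.
  by apply: (@near_neq0 _ _ _ (fun y : state R => y.1)); first exact: cvg_fst.
apply: filterS (filterI h1 x12) => y [y0 y12].
exact/nonterminalP.
Qed.

(** * Parallel pursuit *)

(** The larger root of the quadratic equation in [l] expressing
    [enorm (m + l *: d) = V] when [enorm m = U]. *)
Definition closing_gain (R : realType) (U V : R) (m d : 'rV[R]_3) : R :=
  (Num.sqrt (dot m d ^+ 2 + (V ^+ 2 - U ^+ 2) * dot d d) - dot m d) / dot d d.

(** At capture positions the heading is arbitrary; a constant one keeps
    the speed equal to [V]. *)
Definition parallel_pursuit (R : realType) (U V : R) (mu : state R -> 'rV[R]_3)
    (x : state R) : 'rV[R]_3 :=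
  if x.1 == x.2 then V *: delta_mx 0 0
  else mu x + closing_gain U V (mu x) (x.1 - x.2) *: (x.1 - x.2).

Lemma closing_gain_ge0 (R : realType) (U V : R) (m d : 'rV[R]_3) :
  0 <= U -> U <= V -> 0 <= closing_gain U V m d.
Proof.
move=> U0 UV; have V0 := le_trans U0 UV.
rewrite divr_ge0 ?dot_ge0// subr_ge0 (le_trans (ler_norm _))//.
rewrite -sqrtr_sqr ler_sqrt.
  by rewrite lerDl mulr_ge0 ?dot_ge0// subr_ge0 ler_pXn2r.
by rewrite addr_ge0 ?sqr_ge0// mulr_ge0 ?dot_ge0// subr_ge0 ler_pXn2r.
Qed.

Lemma enorm_closing (R : realType) (U V : R) (m d : 'rV[R]_3) :
  0 <= U -> U <= V -> enorm m = U -> d != 0 ->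
  enorm (m + closing_gain U V m d *: d) = V.
Proof.
move=> U0 UV mU d0; have V0 := le_trans U0 UV.
have D0 : 0 < dot d d by rewrite -enorm_sqr exprn_gt0// enorm_gt0.
set l := closing_gain _ _ _ _.
have lE : l * dot d d + dot m d =
    Num.sqrt (dot m d ^+ 2 + (V ^+ 2 - U ^+ 2) * dot d d).
  by rewrite /l /closing_gain divfK ?subrK// gt_eqF.
have h : (l * dot d d + dot m d) ^+ 2 =
    dot m d ^+ 2 + (V ^+ 2 - U ^+ 2) * dot d d.
  rewrite lE sqr_sqrtr// addr_ge0 ?sqr_ge0// mulr_ge0 ?dot_ge0//.
  by rewrite subr_ge0 ler_pXn2r.
rewrite -[RHS](ger0_norm V0) -sqrtr_sqr /enorm; congr Num.sqrt.
rewrite !(dotDl, dotDr, dotZl, dotZr) (dotC d m) -(enorm_sqr m) mU.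
apply: (mulIf (lt0r_neq0 D0)); move: h; rewrite sqrrD.
set D := dot d d; set b := dot m d => h.
have : (l * D) ^+ 2 + (l * D * b) *+ 2 = (V ^+ 2 - U ^+ 2) * D by lra.
by move=> h2; rewrite -[RHS](subrK (U ^+ 2 * D)) -mulrBl -h2; ring.
Qed.

Lemma feedback_parallel_pursuit (R : realType) (U V : R)
    (mu : state R -> 'rV[R]_3) : 0 <= U -> U < V -> feedback U mu ->
  feedback V (parallel_pursuit U V mu).
Proof.
move=> U0 UV [muU muL]; have V0 := le_lt_trans U0 UV.
split=> [x|x /[dup] /muL mux /nonterminalP[x10 x12]].
  rewrite /parallel_pursuit; case: eqVneq => [_|x12].
    by rewrite enormZ enorm_delta mulr1 gtr0_norm.
  by rewrite enorm_closing ?subr_eq0// ltW.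
apply: (@lip_at_near _ _ _ (fun y : state R =>
    mu y + closing_gain U V (mu y) (y.1 - y.2) *: (y.1 - y.2))).
  apply: filterS (near_distinct x12) => y y12.
  by rewrite /parallel_pursuit (negbTE y12).
have Ld : lip_at (fun y : state R => y.1 - y.2) x.
  by apply: lip_atB; [exact: lip_at_fst|exact: lip_at_snd].
have D0 : 0 < dot (x.1 - x.2) (x.1 - x.2).
  by rewrite -enorm_sqr exprn_gt0// enorm_gt0 subr_eq0.
apply: lip_atD => //; apply: lip_atZ => //.
apply: lip_atM; last first.
  apply: (@lip_at_comp _ _ R R (fun y : state R => dot (y.1 - y.2) (y.1 -
      y.2))).
    exact: lip_at_dot.
  by apply: lip_at_inv; rewrite gt_eqF.
apply: lip_atB; last exact: lip_at_dot.
apply: (@lip_at_comp _ _ R R (fun y : state R => dot (mu y) (y.1 - y.2) ^+ 2 +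
    (V ^+ 2 - U ^+ 2) * dot (y.1 - y.2) (y.1 - y.2)) Num.sqrt).
  apply: lip_atD; first by apply: lip_atM; exact: lip_at_dot.
  by apply: lip_atM; [exact: lip_at_cst|exact: lip_at_dot].
apply: lip_at_sqrt; rewrite ltr_wpDl ?sqr_ge0// mulr_gt0//.
by rewrite subr_gt0 ltr_pXn2r ?nnegrE// ltW.
Qed.

(** Equality in the Cauchy-Schwarz inequality: relative to the
    evader, the pursuer moves straight towards it, and the direction of the line
    of sight is constant. *)
Definition line_of_sight_closing (R : realType)
    (mu nu : state R -> 'rV[R]_3) : Prop :=
  forall x : state R, x.1 != x.2 ->
    dot (x.1 - x.2) (nu x - mu x) = enorm (x.1 - x.2) * enorm (nu x - mu x).

Lemma parallel_pursuit_closing (R : realType) (U V : R)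
    (mu : state R -> 'rV[R]_3) : 0 <= U -> U <= V ->
  line_of_sight_closing mu (parallel_pursuit U V mu).
Proof.
move=> U0 UV x xne; rewrite /parallel_pursuit (negbTE xne) [mu x + _]addrC
    addrK.
by rewrite dotZr enormZ ger0_norm ?closing_gain_ge0// -enorm_sqr; ring.
Qed.

(** The play is produced by [exit_solution] in ['rV_(3 + 3)]. The distance of
    the players decreases at rate [enorm (nu x - mu x) >= V - U], which bounds the
    duration. *)
Lemma exists_play (R : realType) (U V : R) (mu nu : state R -> 'rV[R]_3)
    (x0 : state R) : 0 <= U -> U < V -> feedback U mu -> feedback V nu ->
  line_of_sight_closing mu nu ->
  ~ terminal x0 -> exists T x, is_play mu nu x0 T x.
Proof.
move=> U0 UV [muU muL] [nuV nuL] closing x0nt.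
have V0 := le_lt_trans U0 UV.
have VU : 0 < V - U by rewrite subr_gt0.
pose unpack (v : 'rV[R]_(3 + 3)) : state R := (lsubmx v, rsubmx v).
pose F v : 'rV[R]_(3 + 3) := row_mx (mu (unpack v)) (nu (unpack v)).
pose G : set 'rV[R]_(3 + 3) := [set v | ~ terminal (unpack v)].
have unpackL v : lip_at unpack v.
  apply: (@lip_at_lipschitz _ _ _ _ 1) => y z; rewrite mul1r.
  rewrite [leLHS]/Num.Def.normr /= ge_max; apply/andP; split.
    apply: normr_rV_le => // i.
    by have := normr_coord_le (y - z) (lshift 3 i); rewrite !mxE.
  apply: normr_rV_le => // i.
  by have := normr_coord_le (y - z) (rshift 3 i); rewrite !mxE.
have unpackC : continuous unpack by move=> v; exact: lip_at_continuous.
have row_mx_le (a b : 'rV[R]_3) c : `|a| <= c -> `|b| <= c -> `|row_mx a b| <=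
    c.
  move=> ac bc; apply: normr_rV_le => [|i]; first exact: le_trans ac.
  rewrite mxE; case: splitP => j _; [apply: le_trans ac|apply: le_trans bc];
    exact: normr_coord_le.
have FM v : `|F v| <= V.
  apply: row_mx_le; apply: (le_trans (normr_le_enorm _)); rewrite ?muU ?nuV//.
  exact: ltW.
have oG : open G.
  apply: (@open_comp _ _ unpack [set x | ~ terminal x]) => [v _|].
    exact: unpackC.
  exact: open_nonterminal.
have GL v : G v -> exists2 A, nbhs v A & [lipschitz F w | w in A].
  move=> vG.
  have Lmu : lip_at (fun w => mu (unpack w)) v by apply: lip_at_comp => //;
      exact: muL.
  have Lnu : lip_at (fun w => nu (unpack w)) v by apply: lip_at_comp => //;
      exact: nuL.
  rewrite -/(lip_at F v).
  have -> : F = (fun w => row_mx (mu (unpack w)) 0 + row_mx 0 (nu (unpack w))).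
    by apply/funext => w; rewrite add_row_mx addr0 add0r.
  apply: lip_atD.
    apply: (@lip_at_comp _ _ _ _ _ (fun a : 'rV[R]_3 => row_mx a (0 :
        'rV[R]_3))) => //.
    apply: (@lip_at_lipschitz _ _ _ _ 1) => y z; rewrite mul1r.
    by rewrite opp_row_mx add_row_mx subrr row_mx_le// normr0.
  apply: (@lip_at_comp _ _ _ _ _ (fun a : 'rV[R]_3 => row_mx (0 : 'rV[R]_3) a))
      => //.
  apply: (@lip_at_lipschitz _ _ _ _ 1) => y z; rewrite mul1r.
  by rewrite opp_row_mx add_row_mx subrr row_mx_le// normr0.
have unpackD (x : R -> 'rV[R]_(3 + 3)) (t : R) :
    is_derive t 1 x (F (x t)) ->
    is_derive t 1 (fun t => unpack (x t)) (mu (unpack (x t)), nu (unpack (x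
        t))).
  move=> /is_derive_rVP xd; apply/is_derive_pairP; split=> /=;
      apply/is_derive_rVP => i.
    have := xd (lshift 3 i); rewrite /F row_mxEl.
    by under eq_fun do rewrite -[_ _ (lshift 3 i)](mxE lsubmx_key (fun i j => _
        i (lshift 3 j))).
  have := xd (rshift 3 i); rewrite /F row_mxEr.
  by under eq_fun do rewrite -[_ _ (rshift 3 i)](mxE rsubmx_key (fun i j => _ i
      (rshift 3 j))).
have unpackK : unpack (row_mx x0.1 x0.2) = x0.
  by rewrite /unpack row_mxKl row_mxKr -surjective_pairing.
have Gx0 : G (row_mx x0.1 x0.2) by rewrite /G/= unpackK.
have [T [x [[T0 xx0 xc xd xG] xT]]] :
    exists T x, solution_in F G (row_mx x0.1 x0.2) T x /\ ~ G (x T).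
  apply: (@exit_solution _ _ F G _ V (enorm (x0.1 - x0.2) / (V - U))) => //.
  move=> T x [T0 xx0 xc xd xG].
  rewrite ler_pdivlMr//.
  pose d t := (unpack (x t)).1 - (unpack (x t)).2.
  have dd (t : R) : 0 < t < T -> is_derive t 1 d (mu (unpack (x t)) - nu
      (unpack (x t))).
    by move=> /xd /unpackD /is_derive_pairP[/= d1 d2]; exact: is_deriveB.
  have : - enorm (d 0) - (V - U) * 0 <= - enorm (d T) - (V - U) * T.
    apply: (@derive_ge0_le _ (fun t => - enorm (d t) - (V - U) * t)
      (fun t => enorm (nu (unpack (x t)) - mu (unpack (x t))) - (V - U))) => //.
    - move=> t; apply: (@cvgB _ _ (subspace `[0, T]%classic)).
        apply: (@cvgN _ _ (subspace `[0, T]%classic)).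
        apply: (@continuous_comp (subspace `[0, T]%classic) _ _ x (fun v =>
            enorm ((unpack v).1 - (unpack v).2))).
          exact: xc.
        apply: (@continuous_comp _ _ _ (fun v => (unpack v).1 - (unpack v).2)
            (@enorm R 3)).
          apply: lip_at_continuous; apply: lip_atB.
            by apply: lip_at_comp => //; exact: lip_at_fst.
          by apply: lip_at_comp => //; exact: lip_at_snd.
        exact: continuous_enorm.
      apply: (@cvgM _ (subspace `[0, T]%classic)); first exact: cvg_cst.
      by move: t; apply: continuous_subspaceT => s; exact: cvg_id.
    - move=> t tT.
      have tnt : ~ terminal (unpack (x t)) by apply: xG; case/andP: tT => /ltW
          -> ->.
      have /nonterminalP[_ dt0] := tnt.
      have De : is_derive t 1 (fun t => enorm (d t)) (- enorm (nu (unpack (x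
          t)) - mu (unpack (x t)))).
        have -> : - enorm (nu (unpack (x t)) - mu (unpack (x t))) = dot (d t)
            (mu (unpack (x t)) - nu (unpack (x t))) / enorm (d t).
          rewrite -[mu (unpack (x t)) - nu _]opprB -[- (nu _ - mu _)]scaleN1r
              dotZr.
          rewrite /d closing//; field.
          by rewrite enorm_eq0 subr_eq0.
        by apply: is_derive_enorm; [rewrite subr_eq0|exact: dd].
      by apply: is_derive_eq; rewrite /GRing.scale /= mulr1 opprK.
    - move=> t _; rewrite subr_ge0 lerBlDr -(nuV (unpack (x t))) -(muU (unpack
          (x t))).
      by rewrite -{1}(subrK (mu (unpack (x t))) (nu (unpack (x t)))) enormD.
  have -> : d 0 = x0.1 - x0.2 by rewrite /d xx0 unpackK.
  have := enorm_ge0 (d T); lra.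
exists T, (fun t => unpack (x t)); split=> //.
- by rewrite xx0.
- move=> t; apply: (@continuous_comp (subspace `[0, T]%classic) _ _ x unpack).
    exact: xc.
  exact: unpackC.
- by move=> t /xd /unpackD.
- by split=> [t /xG//|]; apply: contrapT.
Unshelve. all: by end_near.
Qed.

(** * The signed distance from the target to the Apollonius ball *)

(** Signed distance from the target to the Apollonius ball, the candidate
    for the value. *)
Definition apollonius_gap (R : realType) (a : R) (x : state R) : R :=
  enorm (apollonius_center a x) - apollonius_radius a x.

Definition gap_grad1 (R : realType) (a : R) (x : state R) : 'rV[R]_3 :=
  (1 - a ^+ 2)^-1 *:
    ((enorm (apollonius_center a x))^-1 *: apollonius_center a x -
     (a / enorm (x.1 - x.2)) *: (x.1 - x.2)).

Definition gap_grad2 (R : realType) (a : R) (x : state R) : 'rV[R]_3 :=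
  (1 - a ^+ 2)^-1 *:
    ((a / enorm (x.1 - x.2)) *: (x.1 - x.2) -
     (a ^+ 2 / enorm (apollonius_center a x)) *: apollonius_center a x).

Lemma subr1_sqr_gt0 (R : realType) (a : R) : 0 < a -> a < 1 -> 0 < 1 - a ^+ 2.
Proof. by move=> a0 a1; rewrite subr_gt0 expr_lt1// ltW. Qed.

Lemma apollonius_radius_ge0 (R : realType) (a : R) (x : state R) :
  0 < a -> a < 1 -> 0 <= apollonius_radius a x.
Proof.
move=> a0 a1; rewrite /apollonius_radius mulr_ge0 ?enorm_ge0// divr_ge0// ltW//.
exact: subr1_sqr_gt0.
Qed.

(** The difference of the squares of [|c|] and [r] is
    [(|x.1|^2 - a^2 |x.2|^2) / (1 - a^2)]. *)
Lemma gap_gt0 (R : realType) (a : R) (x : state R) : 0 < a -> a < 1 ->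
  (0 < apollonius_gap a x) <-> pursuer_region a x.
Proof.
move=> a0 a1; have k0 := subr1_sqr_gt0 a0 a1.
have r0 := apollonius_radius_ge0 x a0 a1.
rewrite /apollonius_gap subr_gt0 -(@ltr_pXn2r _ 2)// ?nnegrE ?enorm_ge0//.
rewrite /pursuer_region/= /apollonius_radius /apollonius_center enormZ !exprMn.
rewrite !enorm_sqr !(dotBl, dotBr, dotZl, dotZr) (dotC x.2 x.1).
rewrite ger0_norm ?invr_ge0 1?ltW//.
set A := dot x.1 x.1; set B := dot x.2 x.2; set c := dot x.1 x.2.
rewrite -subr_gt0.
have -> : (1 - a ^+ 2)^-1 ^+ 2 * (A - a ^+ 2 * c - (a ^+ 2 * c - a ^+ 2 * (a ^+
    2 * B))) -
   a ^+ 2 * (1 - a ^+ 2)^-1 ^+ 2 * (B - c - (c - A)) =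
   (1 - a ^+ 2)^-1 * (A - a ^+ 2 * B).
  by field; rewrite gt_eqF.
by rewrite pmulr_rgt0 ?invr_gt0.
Qed.

Lemma is_derive_gap (R : realType) (V : normedModType R) (a : R)
    (w : V -> state R) (dw : state R) (x h : V) : 1 - a ^+ 2 != 0 ->
  apollonius_center a (w x) != 0 -> (w x).1 != (w x).2 -> is_derive x h w dw ->
  is_derive x h (fun y => apollonius_gap a (w y))
    (dot (gap_grad1 a (w x)) dw.1 + dot (gap_grad2 a (w x)) dw.2).
Proof.
move=> k0 c0 ne /is_derive_pairP[/= d1 d2].
have dc : is_derive x h (fun y => apollonius_center a (w y))
    ((1 - a ^+ 2)^-1 *: (dw.1 - a ^+ 2 *: dw.2)).
  by apply: is_deriveZ; apply: is_deriveB.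
have dd : is_derive x h (fun y => (w y).2 - (w y).1) (dw.2 - dw.1).
  exact: is_deriveB.
have d0 : (w x).2 - (w x).1 != 0 by rewrite subr_eq0 eq_sym.
have e0 : enorm ((w x).1 - (w x).2) != 0 by rewrite enorm_eq0 subr_eq0.
have eE : enorm ((w x).2 - (w x).1) = enorm ((w x).1 - (w x).2).
  by rewrite -opprB enormN.
have c1 : enorm (apollonius_center a (w x)) != 0 by rewrite enorm_eq0.
have D1 := @is_derive_enorm _ _ _ (fun y => apollonius_center a (w y)) _ _ _ c0
    dc.
have D2 := @is_derive_enorm _ _ _ (fun y => (w y).2 - (w y).1) _ _ _ d0 dd.
rewrite /apollonius_gap /apollonius_radius.
apply: is_derive_eq.
rewrite /GRing.scale/= eE /gap_grad1 /gap_grad2.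
rewrite !(dotZl, dotZr, dotBl, dotBr).
field.
by rewrite k0 c1 e0.
Qed.

(** This identity is the Isaacs equation: the best rates at which the two
    players change the gap cancel out. *)
Lemma enorm_gap_grad (R : realType) (a : R) (x : state R) : 0 < a ->
  a < 1 -> apollonius_center a x != 0 -> x.1 != x.2 ->
  enorm (gap_grad2 a x) = a * enorm (gap_grad1 a x).
Proof.
move=> a0 a1 c0 ne; have k0 := subr1_sqr_gt0 a0 a1.
have -> : a * enorm (gap_grad1 a x) = enorm (a *: gap_grad1 a x).
  by rewrite enormZ ger0_norm// ltW.
rewrite /enorm; congr Num.sqrt.
have e0 : enorm (x.1 - x.2) != 0 by rewrite enorm_eq0 subr_eq0.
have c1 : enorm (apollonius_center a x) != 0 by rewrite enorm_eq0.
rewrite /gap_grad1 /gap_grad2.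
move: (apollonius_center a x) (x.1 - x.2) e0 c1 => c d e0 c1.
rewrite !(dotZl, dotZr, dotBl, dotBr) (dotC d c) -!enorm_sqr.
field.
by rewrite c1 e0 gt_eqF.
Qed.

(** Up to a factor the gradient is the difference of a unit vector and a
    vector of norm [a < 1]. *)
Lemma gap_grad1_neq0 (R : realType) (a : R) (x : state R) : 0 < a ->
  a < 1 -> apollonius_center a x != 0 -> x.1 != x.2 -> gap_grad1 a x != 0.
Proof.
move=> a0 a1 c0 ne; have k0 := subr1_sqr_gt0 a0 a1.
have e0 : enorm (x.1 - x.2) != 0 by rewrite enorm_eq0 subr_eq0.
have c1 : enorm (apollonius_center a x) != 0 by rewrite enorm_eq0.
rewrite /gap_grad1 scaler_eq0 negb_or invr_eq0 gt_eqF//= subr_eq0.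
move: (apollonius_center a x) c1 => c c1; apply/eqP => /(congr1 (@enorm R 3)).
rewrite !enormZ ger0_norm ?invr_ge0 ?enorm_ge0// mulVf//.
rewrite ger0_norm ?divr_ge0 ?enorm_ge0 1?ltW// divfK// => a1'.
by move: a1; rewrite -a1' ltxx.
Qed.

Lemma lip_at_center (R : realType) (a : R) (x : state R) :
  lip_at (apollonius_center a) x.
Proof.
apply: lip_atZ; first exact: lip_at_cst.
apply: lip_atB; first exact: lip_at_fst.
by apply: lip_atZ; [exact: lip_at_cst|exact: lip_at_snd].
Qed.

Lemma continuous_radius (R : realType) (a : R) :
  continuous (apollonius_radius a : state R -> R).
Proof.
move=> x; apply: cvgM; first exact: cvg_cst.
apply: (@continuous_comp _ _ _ (fun y : state R => y.2 - y.1) (@enorm R 3)).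
  by apply: lip_at_continuous; apply: lip_atB; [exact: lip_at_snd|exact:
      lip_at_fst].
exact: continuous_enorm.
Qed.

Lemma continuous_gap (R : realType) (a : R) :
  continuous (apollonius_gap a : state R -> R).
Proof.
move=> x; apply: cvgB; last exact: continuous_radius.
apply: (@continuous_comp _ _ _ (apollonius_center a) (@enorm R 3)).
  exact/lip_at_continuous/lip_at_center.
exact: continuous_enorm.
Qed.

Lemma gap_gt0_center (R : realType) (a : R) (x : state R) : 0 < a ->
  a < 1 -> 0 < apollonius_gap a x -> apollonius_center a x != 0.
Proof.
move=> a0 a1; rewrite /apollonius_gap subr_gt0 => h.
by rewrite -enorm_gt0 (le_lt_trans _ h)// apollonius_radius_ge0.
Qed.

Lemma gap_captured (R : realType) (a : R) (x : state R) : 0 < a ->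
  a < 1 -> x.2 = x.1 -> apollonius_gap a x = enorm x.1.
Proof.
move=> a0 a1 x21; rewrite /apollonius_gap /apollonius_radius /apollonius_center
    x21.
rewrite subrr enorm0 mulr0 subr0 -{1}(scale1r x.1) -scalerBl scalerA mulVf.
  by rewrite scale1r.
by rewrite gt_eqF// subr1_sqr_gt0.
Qed.

Lemma gap_target (R : realType) (a : R) (x : state R) : 0 < a ->
  a < 1 -> x.1 = 0 -> apollonius_gap a x <= 0.
Proof.
move=> a0 a1 x1; rewrite leNgt; apply/negP => /(gap_gt0 _ a0 a1).
rewrite /pursuer_region/= x1 enorm0 expr0n/= sub0r oppr_gt0 ltNge.
by rewrite mulr_ge0// sqr_ge0.
Qed.

Lemma lip_at_grad1 (R : realType) (a : R) (x : state R) :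
  apollonius_center a x != 0 -> x.1 != x.2 -> lip_at (gap_grad1 a) x.
Proof.
move=> c0 ne; have Lc := lip_at_center a x.
have Ld : lip_at (fun y : state R => y.1 - y.2) x.
  by apply: lip_atB; [exact: lip_at_fst|exact: lip_at_snd].
apply: lip_atZ; first exact: lip_at_cst.
apply: lip_atB; apply: lip_atZ => //.
  apply: (@lip_at_comp _ _ R R (fun y => enorm (apollonius_center a y))).
    exact: lip_at_enorm.
  by apply: lip_at_inv; rewrite enorm_eq0.
apply: lip_atM; first exact: lip_at_cst.
apply: (@lip_at_comp _ _ R R (fun y : state R => enorm (y.1 - y.2))).
  by apply: lip_at_enorm => //; rewrite subr_eq0.
by apply: lip_at_inv; rewrite enorm_eq0 subr_eq0.
Qed.

Lemma lip_at_grad2 (R : realType) (a : R) (x : state R) :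
  apollonius_center a x != 0 -> x.1 != x.2 -> lip_at (gap_grad2 a) x.
Proof.
move=> c0 ne; have Lc := lip_at_center a x.
have Ld : lip_at (fun y : state R => y.1 - y.2) x.
  by apply: lip_atB; [exact: lip_at_fst|exact: lip_at_snd].
apply: lip_atZ; first exact: lip_at_cst.
apply: lip_atB; apply: lip_atZ => //; apply: lip_atM; try exact: lip_at_cst.
  apply: (@lip_at_comp _ _ R R (fun y : state R => enorm (y.1 - y.2))).
    by apply: lip_at_enorm => //; rewrite subr_eq0.
  by apply: lip_at_inv; rewrite enorm_eq0 subr_eq0.
apply: (@lip_at_comp _ _ R R (fun y => enorm (apollonius_center a y))).
  exact: lip_at_enorm.
by apply: lip_at_inv; rewrite enorm_eq0.
Qed.

Lemma differentiable_gap (R : realType) (a : R) (x : state R) :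
  apollonius_center a x != 0 -> x.1 != x.2 -> differentiable (apollonius_gap a)
      x.
Proof.
move=> c0 ne.
have d1 : differentiable (fun y : state R => y.1) x.
  by apply: (@linear_differentiable _ _ _ fst) => y; exact: cvg_fst.
have d2 : differentiable (fun y : state R => y.2) x.
  by apply: (@linear_differentiable _ _ _ snd) => y; exact: cvg_snd.
apply: differentiableB.
  apply: (@differentiable_comp _ _ _ _ (apollonius_center a) (@enorm R 3)).
    apply: differentiableZ; apply: differentiableB => //.
    exact: differentiableZ.
  exact: differentiable_enorm.
apply: differentiableM => //.
apply: (@differentiable_comp _ _ _ _ (fun y : state R => y.2 - y.1) (@enorm R
    3)).
  exact: differentiableB.
by apply: differentiable_enorm; rewrite subr_eq0 eq_sym.
Qed.

(** * What the pursuer can guarantee *)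

(** The center of the ball moves with speed equal to the rate of decrease
    of the radius, so [<n, center> - radius] is nondecreasing for every unit vector
    [n]. Fixing for [n] the initial direction of the center avoids any discussion
    of the states where the gap is not differentiable. *)
Lemma closing_payoff_ge (R : realType) (U V : R) (mu nu : state R -> 'rV[R]_3)
    (x0 : state R) (T : R) (x : R -> state R) : 0 < U -> U < V ->
  feedback U mu -> feedback V nu ->
  line_of_sight_closing mu nu ->
  0 < apollonius_gap (U / V) x0 -> is_play mu nu x0 T x ->
  apollonius_gap (U / V) x0 <= enorm (x T).1.
Proof.
move=> U0 UV [muU _] [nuV _] closing W0 [T0 xx0 xc xd [xnt xT]].
have V0 := lt_trans U0 UV.
set a := U / V in W0 *.
have a0 : 0 < a by rewrite divr_gt0.
have a1 : a < 1 by rewrite ltr_pdivrMr// mul1r.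
have k0 := subr1_sqr_gt0 a0 a1.
have UE : U = a * V by rewrite /a divfK// gt_eqF.
have c0 := gap_gt0_center a0 a1 W0.
have c1 : 0 < enorm (apollonius_center a x0) by rewrite enorm_gt0.
pose n := (enorm (apollonius_center a x0))^-1 *: apollonius_center a x0.
have n1 : enorm n = 1.
  by rewrite enormZ normfV ger0_norm ?enorm_ge0// mulVf// gt_eqF.
pose h (y : state R) := dot n (apollonius_center a y) - apollonius_radius a y.
have h_le y : h y <= apollonius_gap a y.
  by rewrite lerD2r (le_trans (cauchy_schwarz _ _))// n1 mul1r.
have h0 : h x0 = apollonius_gap a x0.
  rewrite /h /apollonius_gap /n dotZl -enorm_sqr expr2 mulKf// gt_eqF//.
have hC : continuous h.
  move=> y; apply: cvgB; last exact: continuous_radius.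
  have hL : lip_at (fun z => dot n (apollonius_center a z)) y.
    by apply: lip_at_dot; [exact: lip_at_cst|exact: lip_at_center].
  exact: lip_at_continuous hL.
suff hT : h x0 <= h (x T).
  have WT := le_trans hT (h_le _); rewrite h0 in WT.
  case: xT => [xT0|[xT21 _]].
    by have := lt_le_trans W0 (le_trans WT (gap_target a0 a1 xT0)); rewrite
        ltxx.
  by rewrite (gap_captured a0 a1 xT21) in WT.
rewrite -{1}xx0.
apply: (@derive_ge0_le _ (fun t => h (x t)) (fun t =>
   (1 - a ^+ 2)^-1 * (dot n (mu (x t) - a ^+ 2 *: nu (x t)) +
     a * enorm (nu (x t) - mu (x t))))) => //.
- move=> t; apply: (@continuous_comp (subspace `[0, T]%classic) _ _ x h); first
      exact: xc.
  exact: hC.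
- move=> t tT.
  have /nonterminalP[_ ne] : ~ terminal (x t) by apply: xnt; case/andP: tT =>
      /ltW -> ->.
  have /is_derive_pairP[/= d1 d2] := xd t tT.
  have dc : is_derive t 1 (fun t => apollonius_center a (x t))
      ((1 - a ^+ 2)^-1 *: (mu (x t) - a ^+ 2 *: nu (x t))).
    by apply: is_deriveZ; apply: is_deriveB.
  have dn := is_derive_dot (is_derive_cst n t 1) dc.
  have dd : is_derive t 1 (fun t => (x t).2 - (x t).1) (nu (x t) - mu (x t)).
    exact: is_deriveB.
  have e0 : enorm ((x t).1 - (x t).2) != 0 by rewrite enorm_eq0 subr_eq0.
  have d0 : (x t).2 - (x t).1 != 0 by rewrite subr_eq0 eq_sym.
  have dr := @is_derive_enorm _ _ _ (fun y => (x y).2 - (x y).1) _ _ _ d0 dd.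
  rewrite /h /apollonius_radius.
  apply: is_derive_eq.
  rewrite dot0l addr0 dotZr /GRing.scale/=.
  have -> : dot ((x t).2 - (x t).1) (nu (x t) - mu (x t)) =
      - (enorm ((x t).1 - (x t).2) * enorm (nu (x t) - mu (x t))).
    by rewrite -closing// !(dotBl, dotBr); ring.
  have -> : enorm ((x t).2 - (x t).1) = enorm ((x t).1 - (x t).2).
    by rewrite -opprB enormN.
  by field; rewrite e0 gt_eqF.
- move=> t tT; apply: mulr_ge0; first by rewrite invr_ge0 ltW.
  have -> : a * enorm (nu (x t) - mu (x t)) = enorm (mu (x t) - a ^+ 2 *: nu (x
      t)).
    rewrite -[a in LHS](ger0_norm (ltW a0)) -enormZ /enorm; congr Num.sqrt.
    rewrite !(dotZl, dotZr, dotBl, dotBr) (dotC (nu _)) -!enorm_sqr muU nuV UE.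
    by ring.
  have := cauchy_schwarz (-1 *: n) (mu (x t) - a ^+ 2 *: nu (x t)).
  rewrite dotZl enormZ normrN1 n1 !mul1r mulN1r; lra.
Qed.

(** * What the evader can guarantee *)

(** A positive multiple of the vector from the evader to the point of the
    Apollonius ball closest to the target when the target is outside the ball,
    and to the target itself otherwise. Square root and maximum are in this order
    because the maximum of the squares is positive, hence the square root locally
    Lipschitz, also where the center vanishes. *)
Definition evader_heading (R : realType) (a : R) (x : state R) : 'rV[R]_3 :=
  let c := apollonius_center a x in let d := x.1 - x.2 in
  (a * Num.sqrt (Num.max (dot c c) (apollonius_radius a x ^+ 2))) *: d -
  enorm d *: c.

Definition evader_strategy (R : realType) (U a : R) (x : state R) : 'rV[R]_3 :=
  let w := evader_heading a x in
  if w == 0 then U *: delta_mx 0 0 else (U / enorm w) *: w.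

(** Seen from the evader, the center of the ball lies at distance
    [a * apollonius_radius a x] in the direction opposite to the pursuer. *)
Lemma center_sub (R : realType) (a : R) (x : state R) : 1 - a ^+ 2 != 0 ->
  (a * apollonius_radius a x) *: (x.1 - x.2) =
  enorm (x.1 - x.2) *: (apollonius_center a x - x.1).
Proof.
move=> k0; rewrite /apollonius_radius /apollonius_center.
rewrite -[x.2 - x.1]opprB enormN.
by apply/rowP => i; rewrite !mxE; field.
Qed.

Lemma evader_heading_in (R : realType) (a : R) (x : state R) : 0 < a ->
  a < 1 -> x.1 != x.2 -> 0 < apollonius_gap a x ->
  evader_heading a x =
   (- (1 - a ^+ 2) * enorm (apollonius_center a x) * enorm (x.1 - x.2)) *:
     gap_grad1 a x.
Proof.
move=> a0 a1 ne W0; have k0 := subr1_sqr_gt0 a0 a1.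
have c0 := gap_gt0_center a0 a1 W0.
have r0 := apollonius_radius_ge0 x a0 a1.
have e0 : enorm (x.1 - x.2) != 0 by rewrite enorm_eq0 subr_eq0.
have c1 : enorm (apollonius_center a x) != 0 by rewrite enorm_eq0.
rewrite /evader_heading max_l; last first.
  by move: W0; rewrite subr_gt0 -enorm_sqr => W0; rewrite ler_pXn2r// ?nnegrE
      ?enorm_ge0// ltW.
rewrite -/(enorm _) /gap_grad1.
move: (apollonius_center a x) (x.1 - x.2) c1 e0 => c d c1 e0.
apply/rowP => i; rewrite !mxE; field.
by rewrite c1 e0 gt_eqF.
Qed.

Lemma evader_heading_neq0 (R : realType) (a : R) (x : state R) : 0 < a ->
  a < 1 -> x.1 != 0 -> x.1 != x.2 -> evader_heading a x != 0.
Proof.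
move=> a0 a1 x0 ne; have k0 := subr1_sqr_gt0 a0 a1.
have e0 : enorm (x.1 - x.2) != 0 by rewrite enorm_eq0 subr_eq0.
have r0 := apollonius_radius_ge0 x a0 a1.
have [W0|W0] := ltP 0 (apollonius_gap a x).
  rewrite evader_heading_in// scaler_eq0 negb_or gap_grad1_neq0
      ?(gap_gt0_center _ _ W0)//.
  by rewrite andbT !mulf_neq0// ?oppr_eq0 ?gt_eqF// enorm_gt0 (gap_gt0_center _
      _ W0).
rewrite /evader_heading max_r; last first.
  by move: W0; rewrite subr_le0 -enorm_sqr => W0; rewrite ler_pXn2r// ?nnegrE
      ?enorm_ge0.
rewrite sqrtr_sqr ger0_norm// center_sub ?gt_eqF// -scalerBr addrAC subrr sub0r.
by rewrite scaler_eq0 negb_or e0 oppr_eq0.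
Qed.

Lemma feedback_evader_strategy (R : realType) (U a : R) : 0 < U -> 0 < a ->
  a < 1 -> feedback U (evader_strategy U a).
Proof.
move=> U0 a0 a1; split=> [x|x /nonterminalP[x0 ne]].
  rewrite /evader_strategy; case: eqVneq => [_|w0].
    by rewrite enormZ enorm_delta mulr1 gtr0_norm.
  by rewrite enormZ ger0_norm ?divr_ge0 ?enorm_ge0 1?ltW// divfK// enorm_eq0.
have w0 := evader_heading_neq0 a0 a1 x0 ne.
have Ld : lip_at (fun y : state R => y.1 - y.2) x.
  by apply: lip_atB; [exact: lip_at_fst|exact: lip_at_snd].
have Lc := lip_at_center a x.
have Lr : lip_at (apollonius_radius a) x.
  apply: lip_atM; first exact: lip_at_cst.
  apply: lip_at_enorm; last by rewrite subr_eq0 eq_sym.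
  by apply: lip_atB; [exact: lip_at_snd|exact: lip_at_fst].
have r0 : 0 < apollonius_radius a x.
  rewrite /apollonius_radius mulr_gt0 ?divr_gt0 ?subr1_sqr_gt0//.
  by rewrite enorm_gt0 subr_eq0 eq_sym.
have Lw : lip_at (evader_heading a) x.
  apply: lip_atB; last first.
    by apply: lip_atZ => //; apply: lip_at_enorm => //; rewrite subr_eq0.
  apply: lip_atZ => //; apply: lip_atM; first exact: lip_at_cst.
  apply: (@lip_at_comp _ _ R R (fun y => Num.max (dot (apollonius_center a y)
      (apollonius_center a y)) (apollonius_radius a y ^+ 2)) Num.sqrt).
    by apply: lip_at_max; [exact: lip_at_dot|exact: lip_atM].
  by apply: lip_at_sqrt; rewrite lt_max exprn_gt0 ?orbT.
apply: (@lip_at_near _ _ _ (fun y => (U / enorm (evader_heading a y)) *: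
    evader_heading a y)).
  apply: filterS (near_neq0 (lip_at_continuous Lw) w0) => y yw.
  by rewrite /evader_strategy (negbTE yw).
apply: lip_atZ => //; apply: lip_atM; first exact: lip_at_cst.
apply: (@lip_at_comp _ _ R R (fun y => enorm (evader_heading a y))).
  exact: lip_at_enorm.
by apply: lip_at_inv; rewrite enorm_eq0.
Qed.

(** Where the gap is positive the evader follows its steepest
    descent. *)
Lemma evader_strategy_in (R : realType) (U a : R) (x : state R) : 0 < a ->
  a < 1 -> x.1 != x.2 -> 0 < apollonius_gap a x ->
  evader_strategy U a x = (- (U / enorm (gap_grad1 a x))) *: gap_grad1 a x.
Proof.
move=> a0 a1 ne W0; have k0 := subr1_sqr_gt0 a0 a1.
have c0 := gap_gt0_center a0 a1 W0.
have p0 := gap_grad1_neq0 a0 a1 c0 ne.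
have e0 : 0 < enorm (x.1 - x.2) by rewrite enorm_gt0 subr_eq0.
have c1 : 0 < enorm (apollonius_center a x) by rewrite enorm_gt0.
rewrite /evader_strategy evader_heading_in//.
set k := _ * enorm (x.1 - x.2).
have kn : k < 0 by rewrite /k pmulr_llt0// pmulr_llt0// oppr_lt0.
rewrite scaler_eq0 (negbTE p0) orbF lt_eqF// scalerA enormZ ltr0_norm//.
congr (_ *: _); field.
by rewrite enorm_eq0 p0 lt_eqF.
Qed.

(** If [h T] exceeded both [h 0] and 0, then after the last time at which
    [h] is at most their maximum, [h] would be positive, hence nonincreasing. *)
Lemma last_nonpositive (R : realType) (h dh : R -> R) (T : R) : 0 <= T ->
  {within `[0, T], continuous h} ->
  (forall t, 0 < t < T -> 0 < h t -> is_derive t 1 h (dh t) /\ dh t <= 0) ->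
  h T <= Num.max (h 0) 0.
Proof.
move=> T0 hc hd; rewrite leNgt; apply/negP => hT.
set m := Num.max _ _ in hT.
pose S := [set t | 0 <= t <= T /\ h t <= m].
have supS : has_sup S.
  split; last by exists T => t [/andP[]].
  by exists 0; split; rewrite ?lexx// /m le_max lexx.
pose s := sup S.
have s0 : 0 <= s by apply: sup_upper_bound => //; split; rewrite ?lexx// /m
    le_max lexx.
have sT : s <= T by apply: ge_sup => [|t [/andP[]]//]; exact: supS.1.
have hs : h s <= m.
  rewrite leNgt; apply/negP => hsm.
  have /subspace_continuousP/(_ s) := hc.
  rewrite /= in_itv/= s0 sT => /(_ erefl)/cvgrPdist_lt/(_ (h s - m)).
  rewrite subr_gt0 => /(_ hsm).
  rewrite near_withinE => /nbhs_ballP[e /= e0 eP].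
  have [t [/andP[t0 tT] htm] st] : exists2 t, S t & s - e < t.
    by have [t St] := sup_adherent e0 supS; exists t.
  have ts : t <= s by apply: sup_upper_bound => //; split=> //; rewrite t0.
  have bt : ball s e t by rewrite /ball/= ger0_norm ?subr_ge0// ltrBlDl
      -ltrBlDr.
  have := eP t bt; rewrite /= in_itv/= t0 tT => /(_ erefl).
  by rewrite /from_subspace => /(le_lt_trans (ler_norm _)); lra.
have sT' : s < T.
  rewrite lt_neqAle sT andbT; apply/eqP => sT'.
  by move: hs; rewrite sT' leNgt hT.
have pos t : s < t -> t <= T -> m < h t.
  move=> st tT; rewrite ltNge; apply/negP => htm.
  have : t <= s by apply: sup_upper_bound => //; split=> //; rewrite tT
      (le_trans s0)// ltW.
  by rewrite leNgt st.
have m0 : 0 <= m by rewrite /m le_max lexx orbT.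
have : - h s <= - h T.
  apply: (@derive_ge0_le _ (fun t => - h t) (fun t => - dh t)) => //.
  - move=> t; apply: (@cvgN _ _ (subspace `[s, T]%classic)).
    have : {within `[s, T], continuous h}.
      apply: continuous_subspaceW hc => u /=; rewrite !in_itv/= => /andP[su ->].
      by rewrite (le_trans s0).
    exact.
  - move=> t /andP[st tT]; apply: is_deriveN.
    by have [] := hd t; rewrite ?(le_lt_trans s0 st) ?tT// (le_lt_trans m0)//
        pos// ltW.
  - move=> t /andP[st tT]; rewrite oppr_ge0.
    by have [] := hd t; rewrite ?(le_lt_trans s0 st) ?tT// (le_lt_trans m0)//
        pos// ltW.
rewrite lerN2 => /(lt_le_trans hT) /lt_le_trans /(_ hs).
by rewrite ltxx.
Qed.

(** Where the gap is positive, its derivative along the play is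
    [- U * enorm grad1 + <grad2, nu>], which is nonpositive. Plays that enter the
    region where the gap is nonpositive need no separate treatment: the gap can
    no longer become positive, so that they cannot end with a capture. *)
Lemma evader_payoff_le (R : realType) (U V : R) (nu : state R -> 'rV[R]_3)
    (x0 : state R) (T : R) (x : R -> state R) : 0 < U -> U < V ->
  feedback V nu -> 0 < apollonius_gap (U / V) x0 ->
  is_play (evader_strategy U (U / V)) nu x0 T x ->
  enorm (x T).1 <= apollonius_gap (U / V) x0.
Proof.
move=> U0 UV [nuV _] W0 [T0 xx0 xc xd [xnt xT]].
have V0 := lt_trans U0 UV.
set a := U / V in W0 xd *.
have a0 : 0 < a by rewrite divr_gt0.
have a1 : a < 1 by rewrite ltr_pdivrMr// mul1r.
have k0 := subr1_sqr_gt0 a0 a1.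
have UE : U = a * V by rewrite /a divfK// gt_eqF.
case: xT => [->|[x21 _]]; first by rewrite enorm0 ltW.
rewrite -(gap_captured a0 a1 x21).
have -> : apollonius_gap a x0 = Num.max (apollonius_gap a x0) 0 by rewrite
    max_l// ltW.
rewrite -xx0.
apply: (@last_nonpositive _ (fun t => apollonius_gap a (x t)) (fun t =>
   dot (gap_grad1 a (x t)) (evader_strategy U a (x t)) +
   dot (gap_grad2 a (x t)) (nu (x t)))) => //.
  move=> t; apply: (@continuous_comp (subspace `[0, T]%classic) _ _ x
      (apollonius_gap a)).
    exact: xc.
  exact: continuous_gap.
move=> t tT Wt.
have /nonterminalP[_ ne] : ~ terminal (x t) by apply: xnt; case/andP: tT =>
    /ltW -> ->.
have c0 := gap_gt0_center a0 a1 Wt.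
have p0 := gap_grad1_neq0 a0 a1 c0 ne.
split.
  have := @is_derive_gap _ _ a x _ t 1 _ c0 ne (xd t tT).
  by apply; rewrite gt_eqF.
rewrite evader_strategy_in// dotZr -enorm_sqr.
have := cauchy_schwarz (gap_grad2 a (x t)) (nu (x t)).
rewrite nuV enorm_gap_grad// => h.
have -> : - (U / enorm (gap_grad1 a (x t))) * enorm (gap_grad1 a (x t)) ^+ 2 =
   - (a * enorm (gap_grad1 a (x t)) * V).
  by rewrite {1}UE; field; rewrite enorm_eq0.
by rewrite addrC subr_le0.
Qed.

(** * Value and Isaacs equation *)

(** Both optima are attained at the headings opposite to [p] and parallel to
    [q]; everything else is the Cauchy-Schwarz inequality. *)
Lemma is_min_max_dot (R : realType) (n : nat) (U V : R) (p q : 'rV[R]_n) :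
  0 < U -> 0 < V -> p != 0 -> V * enorm q = U * enorm p ->
  is_min [set m | exists2 u : 'rV[R]_n, enorm u = U &
    is_max [set dot p u + dot q v
           | v in [set v : 'rV[R]_n | enorm v = V]] m] 0.
Proof.
move=> U0 V0 p0 pE.
have p1 : 0 < enorm p by rewrite enorm_gt0.
have q0 : q != 0.
  by rewrite -enorm_gt0 -(pmulr_rgt0 _ V0) pE mulr_gt0.
have q1 : 0 < enorm q by rewrite enorm_gt0.
have vV : enorm ((V / enorm q) *: q) = V.
  by rewrite enormZ ger0_norm ?divr_ge0 ?enorm_ge0 1?ltW// divfK// gt_eqF.
have qv : dot q ((V / enorm q) *: q) = V * enorm q.
  by rewrite dotZr -enorm_sqr; field; rewrite gt_eqF.
split.
  exists ((- (U / enorm p)) *: p).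
    by rewrite enormZ normrN ger0_norm ?divr_ge0 ?enorm_ge0 1?ltW// divfK//
        gt_eqF.
  have pu : dot p ((- (U / enorm p)) *: p) = - (U * enorm p).
    by rewrite dotZr -enorm_sqr; field; rewrite gt_eqF.
  split; first by exists ((V / enorm q) *: q) => //=; rewrite pu qv pE addrC
      subrr.
  move=> _ [v /= vN <-]; rewrite pu addrC subr_le0 -pE mulrC -vN.
  exact: cauchy_schwarz.
move=> m [u uU [_ mub]].
have := mub (dot p u + dot q ((V / enorm q) *: q)) => /(_ _)/(le_trans _);
    apply;
  last by exists ((V / enorm q) *: q).
rewrite qv pE.
have := cauchy_schwarz (-1 *: u) p.
by rewrite dotZl (dotC u) enormZ normrN1 uU; lra.
Qed.

Lemma worst_payoff_ge (R : realType) (U V : R) (mu : state R -> 'rV[R]_3)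
    (x : state R) : 0 < U -> U < V -> feedback U mu ->
  0 < apollonius_gap (U / V) x -> ~ terminal x ->
  exists nu j, [/\ feedback V nu, payoff mu nu x j & apollonius_gap (U / V) x
      <= j].
Proof.
move=> U0 UV muF W0 xnt; have U0' := ltW U0.
pose nu := parallel_pursuit U V mu.
have nuF : feedback V nu by exact: feedback_parallel_pursuit.
have closing : line_of_sight_closing mu nu.
  by apply: parallel_pursuit_closing => //; exact: ltW.
have [T [y yP]] := exists_play U0' UV muF nuF closing xnt.
exists nu, (enorm (y T).1); split=> //; first by exists T, y.
exact: (closing_payoff_ge U0 UV muF nuF closing W0 yP).
Qed.

Lemma worst_payoff_ge_gap (R : realType) (U V : R)
    (mu : state R -> 'rV[R]_3) (x : state R) : 0 < U -> U < V ->
  feedback U mu -> 0 < apollonius_gap (U / V) x -> ~ terminal x ->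
  ((apollonius_gap (U / V) x)%:E <= worst_payoff V mu x)%E.
Proof.
move=> U0 UV muF W0 xnt.
have [nu [j [nuF jP Wj]]] := worst_payoff_ge U0 UV muF W0 xnt.
apply: (@le_trans _ _ j%:E); first by rewrite lee_fin.
by apply: ereal_sup_ubound; exists j => //; exists nu.
Qed.

Lemma worst_payoff_evader (R : realType) (U V : R) (x : state R) :
  0 < U -> U < V -> 0 < apollonius_gap (U / V) x -> ~ terminal x ->
  worst_payoff V (evader_strategy U (U / V)) x = (apollonius_gap (U / V) x)%:E.
Proof.
move=> U0 UV W0 xnt; have V0 := lt_trans U0 UV.
have muF : feedback U (evader_strategy U (U / V)).
  apply: feedback_evader_strategy => //; first exact: divr_gt0.
  by rewrite ltr_pdivrMr// mul1r.
apply/eqP; rewrite eq_le worst_payoff_ge_gap// andbT.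
apply: ge_ereal_sup => _ [j [nu nuF [T [y [yP ->]]]] <-].
by rewrite lee_fin; exact: evader_payoff_le nuF W0 yP.
Qed.

(** The two guarantees coincide, and the pair formed by the evader's strategy
    and parallel pursuit against it attains them. *)
Lemma game_value_gap (R : realType) (U V : R) (x : state R) :
  0 < U -> U < V -> 0 < apollonius_gap (U / V) x -> ~ terminal x ->
  game_value U V x = (apollonius_gap (U / V) x)%:E /\ game_value_attained U V x.
Proof.
move=> U0 UV W0 xnt; have V0 := lt_trans U0 UV.
have muF : feedback U (evader_strategy U (U / V)).
  apply: feedback_evader_strategy => //; first exact: divr_gt0.
  by rewrite ltr_pdivrMr// mul1r.
have wE := worst_payoff_evader U0 UV W0 xnt.
have gE : game_value U V x = (apollonius_gap (U / V) x)%:E.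
  apply/eqP; rewrite eq_le; apply/andP; split.
    rewrite -wE; apply: ereal_inf_lbound.
    by exists (evader_strategy U (U / V)).
  by apply: le_ereal_inf_tmp => _ [mu muF' <-]; exact: worst_payoff_ge_gap.
split=> //; exists (evader_strategy U (U / V)); split=> //; first by rewrite wE.
have [nu [j [nuF jP Wj]]] := worst_payoff_ge U0 UV muF W0 xnt.
exists nu, j; split=> //; rewrite wE; congr EFin; apply/eqP.
rewrite eq_le Wj andbT; case: jP => T [y [yP ->]].
exact: evader_payoff_le nuF W0 yP.
Qed.

Theorem theorem1 (R : realType) (U V : R) (hU : 0 < U) (hV : 0 < V)
    (hUV : U / V < 1) :
  let a := U / V in
  let D := [set x : state R | pursuer_region a x /\ x.1 <> x.2] in
  let W := fun x : state R => fine (game_value U V x) in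
  [/\ (forall x, D x -> game_value_attained U V x),
      C1_on D W,
      (forall x, D x -> HJI_at U V W x) &
      (forall x, D x -> game_value U V x =
         (enorm (apollonius_center a x) - apollonius_radius a x)%:E)].
Proof.
move=> a D W.
have a0 : 0 < a by rewrite divr_gt0.
have UV : U < V by move: hUV; rewrite ltr_pdivrMr// mul1r.
have DP x : D x -> [/\ 0 < apollonius_gap a x, x.1 != x.2, ~ terminal x &
    apollonius_center a x != 0].
  move=> [/(gap_gt0 _ a0 hUV) W0 /eqP ne].
  have c0 := gap_gt0_center a0 hUV W0.
  split=> //; apply/nonterminalP; split=> //; apply/eqP => x1.
  by have := gap_target a0 hUV x1; rewrite leNgt W0.
have val x : D x -> game_value U V x = (apollonius_gap a x)%:E /\
    game_value_attained U V x.
  by move=> /DP[W0 _ xnt _]; exact: game_value_gap.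
have nearD x : D x -> \forall y \near x, D y.
  move=> /[dup] Dx /DP[W0 /near_distinct ne _ _].
  have h : \forall y \near x, 0 < apollonius_gap a y.
    exact: (cvgr_gt _ (@continuous_gap _ a x)).
  apply: filterS (filterI h ne) => y [/(gap_gt0 _ a0 hUV) yP /eqP yne].
  by split.
have nearW x : D x -> \forall y \near x, apollonius_gap a y = W y.
  by move=> /nearD; apply: filterS => y /val[yE _]; rewrite /W yE.
have dW x h : D x -> is_derive x h W
    (dot (gap_grad1 a x) h.1 + dot (gap_grad2 a x) h.2).
  move=> /[dup] Dx /DP[W0 ne _ c0].
  apply: (near_eq_is_derive (nearW x Dx)).
  apply: (@is_derive_gap _ _ a (fun y => y)) => //.
  by rewrite gt_eqF// subr1_sqr_gt0.
split=> [x /val[]//| |x Dx|x /val[]//].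
  move=> x Dx; have [W0 ne _ c0] := DP x Dx; split.
    exact: near_eq_differentiable (nearW x Dx) (differentiable_gap c0 ne).
  move=> h; apply: lip_at_continuous.
  apply: (@lip_at_near _ _ _ (fun y => dot (gap_grad1 a y) h.1 + dot (gap_grad2
      a y) h.2)).
    by apply: filterS (nearD x Dx) => y /(dW y h)[_ ->].
  by apply: lip_atD; apply: lip_at_dot; try exact: lip_at_cst; [exact:
      lip_at_grad1|exact: lip_at_grad2].
have [W0 ne _ c0] := DP x Dx.
have g1 : grad1 W x = gap_grad1 a x.
  apply/rowP => i; rewrite mxE; have [_ ->] := dW x (delta_mx 0 i, 0) Dx.
  rewrite /= [dot (gap_grad2 a x) 0]dotC dot0l addr0.
  exact: dot_delta.
have g2 : grad2 W x = gap_grad2 a x.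
  apply/rowP => i; rewrite mxE; have [_ ->] := dW x (0, delta_mx 0 i) Dx.
  rewrite /= [dot (gap_grad1 a x) 0]dotC dot0l add0r.
  exact: dot_delta.
rewrite /HJI_at g1 g2; apply: is_min_max_dot => //.
  exact: gap_grad1_neq0.
by rewrite enorm_gap_grad// mulrA /a [V * _]mulrC divfK// gt_eqF.
Qed.
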